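(* Let $\mathcal{P}_n$, $n=1,2,\dots$, be pyramids. Then the following (1), (2), and (3) are equivalent to each other. (1) $\{\mathcal{P}_n\}$ is a Lévy family. (2) $\mathcal{P}_n$ converges weakly to $\mathcal{P}_*$ as $n\to\infty$, where $*$ is a one-point mm-space and $\mathcal{P}_*=\{*\}$. (3) $\lim_{n\to\infty}\operatorname{ObsDiam}(\mathcal{P}_n;-\kappa)=0$ for any $\kappa>0$.
   Context: An mm-space is a triple $(X,d_X,\mu_X)$ with $(X,d_X)$ a complete separable metric space and $\mu_X$ a Borel probability measure; we always assume $X=\operatorname{supp}\mu_X$. $\mathcal{X}$ is the set of mm-isomorphism classes of mm-spaces (mm-isomorphism: measure-preserving isometry between supports). $Y\prec X$ means there is a $1$-Lipschitz map $f:X\to Y$ with $f_*\mu_X=\mu_Y$. Box distance: a parameter of $X$ is a Borel map $\varphi:I=[0,1)\to X$ with $\varphi_*\mathcal{L}^1=\mu_X$. $\square(X,Y)$ is the infimum of $\varepsilon\ge0$ such that there are parameters $\varphi$ of $X$, $\psi$ of $Y$ and a Borel set $I_0\subset I$ with $\mathcal{L}^1(I_0)\ge1-\varepsilon$ and $|d_X(\varphi(s),\varphi(t))-d_Y(\psi(s),\psi(t))|\le\varepsilon$ for all $s,t\in I_0$. It is a metric on $\mathcal{X}$. A pyramid is a nonempty $\square$-closed subset $\mathcal{P}\subset\mathcal{X}$ such that (i) $X\in\mathcal{P}$ and $Y\prec X$ imply $Y\in\mathcal{P}$; (ii) for any $X,X'\in\mathcal{P}$ there is $Y\in\mathcal{P}$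 with $X\prec Y$, $X'\prec Y$. Weak convergence $\mathcal{P}_n\to\mathcal{P}$: $\lim_{n}\square(X,\mathcal{P}_n)=0$ for every $X\in\mathcal{P}$, and $\liminf_n\square(X,\mathcal{P}_n)>0$ for every $X\in\mathcal{X}\setminus\mathcal{P}$, where $\square(X,\mathcal{P}_n)=\inf_{Y\in\mathcal{P}_n}\square(X,Y)$. Observable diameter: for a Borel probability measure $\nu$ on a metric space and $\alpha\in\mathbb{R}$, $\operatorname{diam}(\nu;\alpha)$ is the infimum of $\operatorname{diam}(A)$ over Borel sets $A$ with $\nu(A)\ge\alpha$ (so it is $0$ if $\alpha\le0$). For an mm-space $X$ and $\kappa>0$, $\operatorname{ObsDiam}(X;-\kappa)=\sup\{\operatorname{diam}(f_*\mu_X;1-\kappa)\mid f:X\to\mathbb{R}\text{ is }1\text{-Lipschitz}\}$. For a pyramid, $\operatorname{ObsDiam}(\mathcal{P};-\kappa)=\lim_{\delta\to0+}\sup_{X\in\mathcal{P}}\operatorname{ObsDiam}(X;-(\kappa+\delta))\in[0,+\infty]$. Separation distance: for an mm-space $X$ and $\kappa_0,\kappa_1>0$, $\operatorname{Sep}(X;\kappa_0,\kappa_1)$ is the supremum of $d_X(A_0,A_1)=\inf_{x\in A_0,y\in A_1}d_X(x,y)$ over Borel sets $A_0,A_1\subset X$ with $\mu_X(A_i)\ge\kappa_i$; it is $0$ if no such sets exist. For a pyramid, $\operatorname{Sep}(\mathcal{P};\kappa_0,\kappa_1)=\lim_{\delta\to0+}\sup_{X\in\mathcal{P}}\operatorname{Sep}(X;\kappa_0-\delta,\kappa_1-\delta)\in[0,+\infty]$.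 $\{\mathcal{P}_n\}$ is a Lévy family if $\lim_{n\to\infty}\operatorname{Sep}(\mathcal{P}_n;\kappa_0,\kappa_1)=0$ for any $\kappa_0,\kappa_1>0$ with $\kappa_0+\kappa_1<1$. *)

(* Defs.v *)
From HB Require Import structures.
From mathcomp Require Import all_boot all_order all_algebra.
From mathcomp Require Import all_classical all_reals all_analysis.

Set Implicit Arguments.
Unset Strict Implicit.
Unset Printing Implicit Defensive.

Import Order.TTheory GRing.Theory Num.Theory.
Import numFieldNormedType.Exports.

Local Open Scope classical_set_scope.
Local Open Scope ring_scope.

#[short(type="completeMetricType")]
HB.structure Definition CompleteMetric (R : numDomainType) :=
  {T of Complete T & Metric R T}.

Definition separable (T : topologicalType) : Prop :=
  exists2 D : set T, countable D & dense D.

Definition borelType (T : ptopologicalType) := g_sigma_algebraType (@open T).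

(* The measurable sets of borelType T. *)
Definition borel (T : topologicalType) : set (set T) := <<s @open T >>.

Definition supp (R : realType) (T : ptopologicalType)
    (mu : set (borelType T) -> \bar R) : set T :=
  [set x | forall U : set T, open_nbhs x U -> (0 < mu U)%E].

(* completeMetricType includes a base point, which no definition below uses. *)
Record mmSpace (R : realType) := MMSpace {
  mm_carrier :> completeMetricType R ;
  mm_separable : separable mm_carrier ;
  mm_mu : probability (borelType mm_carrier) R ;
  mm_full_support : supp mm_mu = [set: mm_carrier] }.

Definition lipschitz1 (R : realType) (T U : metricType R) (f : T -> U) : Prop :=
  forall x y, mdist (f x) (f y) <= mdist x y.

Definition measure_preserving (R : realType) (X Y : mmSpace R) (f : X -> Y) :
    Prop :=
  measurable_fun [set: borelType X] (f : borelType X -> borelType Y) /\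
  forall A : set (borelType Y), measurable A ->
    pushforward (mm_mu X) (f : borelType X -> borelType Y) A = mm_mu Y A.

(* Both spaces are the supports of their measures, so an isometry between the
   supports is an isometric bijection. *)
Definition mm_iso (R : realType) (X Y : mmSpace R) : Prop :=
  exists f : X -> Y, [/\ bijective f,
    forall x y, mdist (f x) (f y) = mdist x y & measure_preserving f].

(* dominated Y X is the Lipschitz order: Y \prec X. *)
Definition dominated (R : realType) (Y X : mmSpace R) : Prop :=
  exists f : X -> Y, lipschitz1 f /\ measure_preserving f.

(* Only the values of phi on [0, 1[ matter. *)
Definition parameter (R : realType) (X : mmSpace R) (phi : R -> X) : Prop :=
  measurable_fun (`[0, 1[ : set (measurableTypeR R))
    (phi : measurableTypeR R -> borelType X) /\
  forall A : set (borelType X), measurable A ->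
    lebesgue_measure (`[0, 1[ `&` phi @^-1` A) = mm_mu X A.

Definition box_dist (R : realType) (X Y : mmSpace R) : \bar R :=
  ereal_inf [set e%:E | e in [set e : R | 0 <= e /\
    exists (phi : R -> X) (psi : R -> Y),
      [/\ parameter phi, parameter psi &
       exists I0 : set (measurableTypeR R),
        [/\ measurable I0, I0 `<=` `[0, 1[,
            ((1 - e)%:E <= lebesgue_measure I0)%E &
            forall s t, I0 s -> I0 t ->
              `|mdist (phi s) (phi t) - mdist (psi s) (psi t)| <= e]]]].

Definition box_dist_set (R : realType) (X : mmSpace R) (P : set (mmSpace R)) :
    \bar R :=
  ereal_inf [set box_dist X Y | Y in P].

(* A set of mm-isomorphism classes is represented by the set of all mm-spaces
   whose class belongs to it, i.e., by a set of mm-spaces that is invariant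
   under mm-isomorphism. *)
Definition iso_invariant (R : realType) (P : set (mmSpace R)) : Prop :=
  forall X Y : mmSpace R, mm_iso X Y -> P X -> P Y.

Definition box_closed (R : realType) (P : set (mmSpace R)) : Prop :=
  forall X : mmSpace R,
    (forall e : R, 0 < e -> exists2 Y, P Y & (box_dist X Y < e%:E)%E) -> P X.

Record pyramid (R : realType) (P : set (mmSpace R)) : Prop := Pyramid {
  pyramid_iso : iso_invariant P ;
  pyramid_nonempty : P !=set0 ;
  pyramid_closed : box_closed P ;
  pyramid_down : forall X Y, P X -> dominated Y X -> P Y ;
  pyramid_directed : forall X X', P X -> P X' ->
    exists Y, [/\ P Y, dominated X Y & dominated X' Y] }.

Definition weakly_converges (R : realType) (P : nat -> set (mmSpace R))
    (Q : set (mmSpace R)) : Prop :=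
  (forall X, Q X -> box_dist_set X (P n) @[n --> \oo] --> 0%E) /\
  (forall X, ~ Q X -> (0 < limn_einf (fun n => box_dist_set X (P n)))%E).

(* The point 0 is added so that the diameter of the empty set is 0. *)
Definition diam (R : realType) (T : metricType R) (A : set T) : \bar R :=
  ereal_sup (0%E |` [set (mdist x y)%:E | x in A & y in A]).

(* diam(nu; alpha) *)
Definition partial_diam (R : realType) (T : metricType R) (nu : set T -> \bar R)
    (alpha : R) : \bar R :=
  ereal_inf [set diam A | A in [set A | borel A /\ (alpha%:E <= nu A)%E]].

(* obs_diam X kappa is ObsDiam(X; - kappa); likewise for pyramids below. *)
Definition obs_diam (R : realType) (X : mmSpace R) (kappa : R) : \bar R :=
  ereal_sup [set partial_diam
      (pushforward (mm_mu X) (f : borelType X -> borelType R^o)) (1 - kappa)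
    | f in [set f : X -> R^o | lipschitz1 f]].

Definition pyr_obs_diam (R : realType) (P : set (mmSpace R)) (kappa : R) :
    \bar R :=
  lim (ereal_sup [set obs_diam X (kappa + d) | X in P] @[d --> 0^'+]).

Definition set_dist (R : realType) (T : metricType R) (A B : set T) : \bar R :=
  ereal_inf [set (mdist x y)%:E | x in A & y in B].

(* The point 0 is added so that the supremum is 0 when there are no such sets;
   it changes nothing otherwise, since distances are nonnegative. *)
Definition sep_dist (R : realType) (X : mmSpace R) (k0 k1 : R) : \bar R :=
  ereal_sup (0%E |` [set r | exists A0 A1 : set (borelType X),
    [/\ measurable A0, measurable A1, (k0%:E <= mm_mu X A0)%E,
        (k1%:E <= mm_mu X A1)%E & r = @set_dist R X A0 A1]]).

Definition pyr_sep_dist (R : realType) (P : set (mmSpace R)) (k0 k1 : R) :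
    \bar R :=
  lim (ereal_sup [set sep_dist X (k0 - d) (k1 - d) | X in P] @[d --> 0^'+]).

Definition levy_family (R : realType) (P : nat -> set (mmSpace R)) : Prop :=
  forall k0 k1 : R, 0 < k0 -> 0 < k1 -> k0 + k1 < 1 ->
    pyr_sep_dist (P n) k0 k1 @[n --> \oo] --> 0%E.

(* The parameter R is only there to carry a metric with values in R. *)
Definition point_type (R : realType) : Type := unit.

Section one_point_space.
Variable R : realType.
Local Notation T := (point_type R).

HB.instance Definition _ := Choice.on T.
HB.instance Definition _ := Pointed.on T.

Let dist (_ _ : T) : R := 0.
Let distxx x : dist x x = 0. Proof. by []. Qed.
Let dist_pos x y : dist x y = 0 -> x = y. Proof. by case: x; case: y. Qed.
Let dist_sym x y : dist x y = dist y x. Proof. by []. Qed.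
Let dist_tri y x z : dist x z <= dist x y + dist y z.
Proof. by rewrite /dist addr0. Qed.

HB.instance Definition _ := isMetric.Build R T distxx dist_pos dist_sym dist_tri.

Let complete (F : set_system T) : ProperFilter F -> cauchy F -> cvg F.
Proof.
move=> FF _; apply/cvg_ex; exists (tt : T) => A /nbhs_singleton Att.
by apply: filterS filterT => -[] _.
Qed.

HB.instance Definition _ := Uniform_isComplete.Build T complete.

Lemma point_separable : separable T.
Proof.
exists setT; first exact: countableP.
by move=> U U0 _; rewrite setIT.
Qed.

Definition point_measure : probability (borelType T) R :=
  dirac (tt : borelType T).

Lemma point_full_support : supp point_measure = [set: T].
Proof.
apply/seteqP; split => // -[] _ U [_ Utt].
by rewrite /point_measure /= diracE mem_set.
Qed.

Definition one_point : mmSpace R :=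
  MMSpace point_separable point_full_support.

End one_point_space.

(* {*}, as a set of mm-isomorphism classes *)
Definition pyramid_point (R : realType) : set (mmSpace R) :=
  [set X | mm_iso X (one_point R)].
Arguments pyramid_point R : clear implicits.

(* Main.v *)
(** (1) => (2): a space [X] other than the point carries two balls of positive
    measure at positive distance. If [Y] is box-close to [X], the closures of
    the images under a parameter of [Y] of the two parameter sets of the balls
    are still separated, so [Sep] would not tend to 0.

    (2) => (3): if observable diameters do not tend to 0, truncating an
    observable between its two extreme quantiles gives measures on [[0, c]]
    with definite mass at both [0] and [c], whose supports belong to the
    pyramids. Their quantile functions are nondecreasing and have a pointwise
    cluster point [g]; by monotonicity, closeness on a fine grid gives closeness
    off a set of small measure, so the law of [g] is a box-distance cluster
    point of the pyramids, and it is not the point.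

    (3) => (1): the distance function to one of two separated sets is an
    observable whose law needs a large diameter to carry most of the mass. *)

From HB Require Import structures.
Require Import Defs.
From mathcomp Require Import all_boot all_order all_algebra.
From mathcomp Require Import all_classical all_reals all_analysis.
From mathcomp Require Import measurable_realfun lra.
Import Order.TTheory GRing.Theory Num.Theory.
Import numFieldNormedType.Exports.
Local Open Scope classical_set_scope.
Local Open Scope ring_scope.

Set Implicit Arguments.
Unset Strict Implicit.

(** * The metric measure space carried by the support of a law on the line *)

Lemma measurable_fun_borel d (T : measurableType d) (U : ptopologicalType)
    (D : set T) (f : T -> borelType U) :
  (forall O : set U, open O -> measurable (D `&` f @^-1` O)) ->
  measurable_fun D f.
Proof.
move=> h; apply: (@measurability _ _ _ (borelType U) D f (@open U)) => //.
by move=> _ [V oV <-]; exact: h.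
Qed.

Section line_space.
Variables (R : realType) (nu : probability (measurableTypeR R) R).

Definition line_supp : set R := @supp R R^o nu.

(** Rational endpoints keep the family of null intervals countable; this is what makes the
    complement of the support null in [line_suppC0]. *)
Lemma line_suppN x : ~ line_supp x ->
  exists p : rat * rat, [/\ nu `]ratr p.1, ratr p.2[%classic = 0%E,
    ratr p.1 < x & x < ratr p.2].
Proof.
move=> /existsNP[U] /not_implyP[] [oU Ux] /negP.
rewrite -leNgt => U0.
have /nbhs_ballP[e /= e0 eU] : nbhs (x : R^o) U by exact: open_nbhs_nbhs.
have [|p /andP[xp px]] := @rat_in_itvoo R (x - e) x.
  by rewrite ltrBlDr ltrDl.
have [|q /andP[xq qx]] := @rat_in_itvoo R x (x + e).
  by rewrite ltrDl.
exists (p, q) => //=; split=> //.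
apply/eqP; rewrite eq_le measure_ge0 andbT (le_trans _ U0)//.
have mU : measurable (U : set (measurableTypeR R)) by exact: open_measurable.
apply: le_measure; rewrite ?inE// => y /=; rewrite in_itv/= => /andP[py yq].
move: xp qx; rewrite !bnd_simp => xp qx.
by apply: eU; rewrite /ball/= ltr_norml; apply/andP; split; lra.
Qed.

(** A null interval around one point outside the support keeps all its points outside. Closedness is
    what makes the support a complete metric space. *)
Lemma closed_line_supp : closed line_supp.
Proof.
rewrite -[line_supp]setCK; apply: open_closedC.
rewrite openE => x /line_suppN[p [p0 px xp]].
pose I : set R := `]ratr p.1, ratr p.2[%classic.
have oI : open I by exact: interval_open.
have Ix : open_nbhs (x : R) I by split => //=; rewrite /I /= in_itv/= px.
apply: (filterS _ (open_nbhs_nbhs Ix)) => y Iy /(_ I (conj oI Iy)).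
by rewrite p0 ltxx.
Qed.

Lemma measurable_line_supp : measurable (line_supp : set (measurableTypeR R)).
Proof. by apply: closed_measurable; exact: closed_line_supp. Qed.

Lemma line_suppC0 : nu (~` line_supp) = 0%E.
Proof.
apply: measure_negligible.
  by apply: measurableC; exact: measurable_line_supp.
(* [F] runs through the rational intervals by their codes and keeps only the null ones. *)
pose F (n : nat) : set R := if unpickle n is Some p then
  [set x | nu `]ratr p.1, ratr p.2[%classic = 0%E /\
    ratr (p : rat * rat).1 < x < ratr p.2] else set0.
apply: (@negligibleS _ _ _ nu (\bigcup_n F n)).
  move=> x /line_suppN[p [p0 px xp]]; exists (pickle p); first exact: I.
  by rewrite /F pickleK; split=> //; rewrite px.
apply: negligible_bigcup => n; rewrite /F; case: unpickle => [p|].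
  have [p0|p0] := eqVneq (nu `]ratr p.1, ratr p.2[%classic) 0%E.
    exists `]ratr p.1, ratr p.2[%classic; split => //= x /= [_].
    by rewrite in_itv.
  apply: (negligibleS _ (negligible_set0 _)) => x [p0'].
  by rewrite p0' eqxx in p0.
exact: negligible_set0.
Qed.

Lemma line_supp1 : nu line_supp = 1%E.
Proof.
have := probability_setT nu; rewrite -(setUv line_supp) measureU//=.
- by rewrite line_suppC0 adde0.
- exact: measurable_line_supp.
- by apply: measurableC; exact: measurable_line_supp.
- by rewrite setICr.
Qed.

Lemma line_supp_neq0 : line_supp !=set0.
Proof.
apply/set0P/negP => /eqP s0; have := line_supp1.
by rewrite s0 measure0 => /eqP; rewrite eqe eq_sym oner_eq0.
Qed.

(** The carrier is the support and not the whole line, since an mm-space must have full support. *)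
Definition line_type : Type := {x : R | line_supp x}.
HB.instance Definition _ := gen_eqMixin line_type.
HB.instance Definition _ := gen_choiceMixin line_type.
HB.instance Definition _ := isPointed.Build line_type
  (exist _ _ (projT2 (cid line_supp_neq0))).

Let dist (x y : line_type) : R := `|sval x - sval y|.
Let distxx x : dist x x = 0. Proof. by rewrite /dist subrr normr0. Qed.
Let dist_pos x y : dist x y = 0 -> x = y.
Proof.
case: x y => [x xS] [y yS] /eqP; rewrite /dist/= normr_eq0 subr_eq0 => /eqP xy.
by move: xS; rewrite xy => xS; congr exist.
Qed.
Let dist_sym x y : dist x y = dist y x. Proof. exact: distrC. Qed.
Let dist_tri y x z : dist x z <= dist x y + dist y z.
Proof. exact: ler_distD. Qed.

HB.instance Definition _ :=
  isMetric.Build R line_type distxx dist_pos dist_sym dist_tri.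

Lemma line_ball (x : line_type) e :
  ball x e = [set y : line_type | `|sval x - sval y| < e].
Proof. exact: ballEmdist. Qed.

Let line_complete (F : set_system line_type) :
  ProperFilter F -> cauchy F -> cvg F.
Proof.
move=> FF cF.
have : cauchy ((sval : _ -> R) @ F).
  apply: (@cauchy_exP R R^o) => e e0; move/cauchyP : cF => /(_ _ e0)[x Fx].
  exists (sval x); 
  suff : F (sval @^-1` ball (sval x : R^o) e) by [].
  by apply: filterS Fx => y; rewrite line_ball.
move=> /cauchy_cvg/cvg_ex[l Fl].
have Sl : line_supp l.
  apply: (@closed_cvg _ R F _ sval line_supp closed_line_supp _ l Fl).
  by apply: nearW => -[].
apply/cvg_ex; exists (exist _ l Sl : line_type).
apply/cvg_ballP => e e0.
move/cvg_ballP : Fl => /(_ _ e0).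
by apply: filterS => x; rewrite line_ball.
Qed.
HB.instance Definition _ := Uniform_isComplete.Build line_type line_complete.

(** The dense set takes one point of the support in each rational interval that meets it. *)
Lemma line_separable : separable line_type.
Proof.
pose pick (p : rat * rat) : set line_type :=
  [set x | exists2 y : line_type, ratr p.1 < sval y < ratr p.2 &
    x = xget point [set y : line_type | ratr p.1 < sval y < ratr p.2]].
exists (\bigcup_p pick p).
  apply: bigcup_countable => // p _; apply: (@sub_countable _ _ _
    [set xget point [set y : line_type | ratr p.1 < sval y < ratr p.2]]) => //.
  by apply: subset_card_le => x [y _ ->].
move=> U [x Ux] oU.
have /nbhs_ballP[e /= e0 eU] : nbhs x U by exact: open_nbhs_nbhs.
have [|p /andP[]] := @rat_in_itvoo R (sval x - e) (sval x).
  by rewrite ltrBlDr ltrDl.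
have [|q /andP[]] := @rat_in_itvoo R (sval x) (sval x + e).
  by rewrite ltrDl.
rewrite !bnd_simp => xq qx xp px.
pose y := xget point [set y : line_type | ratr p < sval y < ratr q].
have /andP[py yq] : ratr p < sval y < ratr q.
  by apply: (@xgetPex _ point [set y : line_type | ratr p < sval y < ratr q]);
    exists x => /=; rewrite px.
exists y; split.
  by apply: eU; rewrite line_ball/= ltr_norml; apply/andP; split; lra.
by exists (p, q) => //; exists x => //=; rewrite px.
Qed.

(** A total map on the line; the base point is its value off the support, a null set, so that this
    value does not affect the law. *)
Definition line_proj (x : R) : line_type :=
  if pselect (line_supp x) is left xS then exist _ x xS else point.

Lemma line_projE x : line_supp x -> sval (line_proj x) = x.
Proof. by rewrite /line_proj; case: pselect. Qed.

(** On the support, the preimage of an open set is the trace of a union [O] of balls of the line.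
    Off the support everything goes to the base point, whence the two cases. *)
Lemma measurable_line_proj :
  measurable_fun setT (line_proj : measurableTypeR R -> borelType line_type).
Proof.
apply: measurable_fun_borel => U oU; rewrite setTI.
pose O : set R := \bigcup_(p in [set p : line_type * R | ball p.1 p.2 `<=` U])
  ball (sval p.1 : R) p.2.
have oO : open O by apply: bigcup_open => p _; exact: ball_open.
have mO : measurable (O : set (measurableTypeR R)) by exact: open_measurable.
have OU x : line_supp x -> O x <-> U (line_proj x).
  move=> xS; split=> [[p /= pU px]|Ux].
    by apply: pU; rewrite line_ball/= line_projE.
  have /nbhs_ballP[e /= e0 eU] : nbhs (line_proj x) U by exact: open_nbhs_nbhs.
  by exists (line_proj x, e) => //=; rewrite line_projE//; exact: ballxx.
have mS := measurable_line_supp.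
have [Up|Up] := pselect (U point).
  rewrite (_ : _ @^-1` _ = O `|` ~` line_supp); last first.
    apply/seteqP; split => x /=.
      by have [xS|xS] := pselect (line_supp x); [move/OU|]; auto.
    have [xS|xS] := pselect (line_supp x) => -[Ox|//]; first exact/OU.
      by rewrite /line_proj; case: pselect.
    by rewrite /line_proj; case: pselect.
  by apply: measurableU => //; exact: measurableC.
rewrite (_ : _ @^-1` _ = O `&` line_supp); last first.
  apply/seteqP; split => x /=; last by move=> [Ox xS]; exact/OU.
  have [xS|xS] := pselect (line_supp x); first by move/OU; auto.
  by rewrite /line_proj; case: pselect.
exact: measurableI.
Qed.

HB.instance Definition _ := @isMeasurableFun.Build _ _ _ _
  (line_proj : measurableTypeR R -> borelType line_type) measurable_line_proj.

Definition line_mu : probability (borelType line_type) R :=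
  distribution nu (line_proj : measurableTypeR R -> borelType line_type).

Lemma line_full_support : supp line_mu = [set: line_type].
Proof.
apply/seteqP; split => // x _ U [oU Ux].
have /nbhs_ballP[e /= e0 eU] : nbhs x U by exact: open_nbhs_nbhs.
have [oB Bx] : open_nbhs (sval x : R) (ball (sval x : R) e).
  by split; [exact: ball_open|exact: ballxx].
have := proj2_sig x _ (conj oB Bx); move/lt_le_trans; apply.
rewrite [leRHS](_ : _ = nu (line_proj @^-1` U))//.
have mB : measurable (ball (sval x : R) e : set (measurableTypeR R)).
  exact: open_measurable.
have mU : measurable (line_proj @^-1` U : set (measurableTypeR R)).
  by rewrite -[X in measurable X]setTI; apply: measurable_line_proj => //;
    exact: sub_sigma_algebra.
have mSC := measurableC measurable_line_supp.
(* The ball needs to lie in the preimage of [U] only up to the null complement of the support. *)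
rewrite -(measureU0 mU mSC line_suppC0); apply: le_measure.
- by rewrite inE.
- by rewrite inE; exact: measurableU.
move=> y xy; have [yS|yS] := pselect (line_supp y); [left|by right].
by apply: eU; rewrite line_ball/= line_projE.
Qed.

Definition line_space : mmSpace R := MMSpace line_separable line_full_support.

Definition line_space_proj : R -> line_space := line_proj.

Definition line_space_val : line_space -> R := sval.

Lemma line_space_mdist (x y : line_space) :
  mdist x y = `|line_space_val x - line_space_val y|.
Proof. by []. Qed.

Lemma line_space_projE x :
  line_supp x -> line_space_val (line_space_proj x) = x.
Proof. exact: line_projE. Qed.

Lemma line_space_mu (A : set (borelType line_space)) :
  mm_mu line_space A = nu (line_space_proj @^-1` A).
Proof. by []. Qed.

Lemma measurable_line_space_proj : measurable_fun setT
  (line_space_proj : measurableTypeR R -> borelType line_space).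
Proof. exact: measurable_line_proj. Qed.

End line_space.

(** * Quantile functions *)

Section unit_measure.
Variable R : realType.

(** Lebesgue measure on [[0, 1[] seen as a probability on the whole line, so that parameters and
    quantile functions can be total functions on [R]. *)
Definition unit_leb : set (measurableTypeR R) -> \bar R :=
  mrestr lebesgue_measure (measurable_itv `[0 : R, 1[).

HB.instance Definition _ := Measure.copy unit_leb
  (mrestr lebesgue_measure (measurable_itv `[0 : R, 1[)).

Lemma unit_lebE A : unit_leb A = lebesgue_measure (`[0, 1[ `&` A).
Proof. by rewrite setIC. Qed.

Lemma unit_leb_setI A : unit_leb (A `&` `[0, 1[%classic) = unit_leb A.
Proof. by rewrite /unit_leb /mrestr -setIA setIid. Qed.

Let unit_leb_setT : unit_leb setT = 1%E.
Proof.
by rewrite unit_lebE setIT lebesgue_measure_itv/= lte_fin ltr01 oppr0 adde0.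
Qed.

HB.instance Definition _ := Measure_isProbability.Build _ _ _
  unit_leb unit_leb_setT.

Lemma unit_leb_ocitv (a : R) : 0 <= a <= 1 -> unit_leb `]-oo, a]%classic = a%:E.
Proof.
move=> /andP[a0 a1]; rewrite unit_lebE.
have [a1'|a1'] := eqVneq a 1.
  rewrite (_ : _ `&` _ = `[0, 1[%classic).
    by rewrite lebesgue_measure_itv/= lte_fin ltr01 oppr0 adde0 a1'.
  apply/seteqP; split => x; rewrite /= !in_itv/= ?a1'; first by case.
  by move=> /andP[-> x1]; rewrite x1 (ltW x1).
rewrite (_ : _ `&` _ = `[0, a]%classic).
  rewrite lebesgue_measure_itv/= lte_fin; case: ltP => [_|a0'].
    by rewrite oppr0 adde0.
  by congr EFin; apply/eqP; rewrite eq_le a0 a0'.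
apply/seteqP; split => x; rewrite /= !in_itv/=.
  by move=> [/andP[-> _] ->].
move=> /andP[-> xa]; split=> //=; rewrite (le_lt_trans xa)//.
by rewrite lt_neqAle a1'.
Qed.

(** The complements of these rays are the open right rays, a generating class closed under
    intersection. *)
Lemma eq_rays_measure (m1 m2 : probability (measurableTypeR R) R) :
  (forall x, m1 `]-oo, x]%classic = m2 `]-oo, x]%classic) ->
  forall A, measurable A -> m1 A = m2 A.
Proof.
move=> m12 A mA.
apply: (@measure_unique _ R (measurableTypeR R) (@RGenOInfty.G R)
  (fun n => `](- n%:R)%R, +oo[%classic)) => //.
- exact: RGenOInfty.measurableE.
- move=> _ _ [x ->] [y ->]; exists (Num.max x y).
  apply/seteqP; split => z /=; rewrite !in_itv/= !andbT gt_max.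
    by move=> [-> ->].
  by move/andP.
- by move=> n; exists (- n%:R).
- apply/seteqP; split => // x _; exists (Num.truncn `|x|).+1 => //=.
  rewrite in_itv/= andbT ltrNl.
  by rewrite (le_lt_trans _ (truncnS_gt _))// -normrN ler_norm.
- move=> _ [x ->]; rewrite -setCitvl.
  have mx : measurable (`]-oo, x]%classic : set (measurableTypeR R)).
    exact: measurable_itv.
  transitivity (1 - m1 `]-oo, x]%classic)%E; first exact: probability_setC.
  by rewrite m12; apply/esym; exact: probability_setC.
- by move=> n; rewrite (le_lt_trans (probability_le1 _ _)) ?ltry.
Qed.

(** Right continuity of the distribution function: the rays ending at [x + 1 / (n + 1)] decrease to
    the ray ending at [x]. *)
Lemma ray_right_lt (m : probability (measurableTypeR R) R) (x : R)
    (t : \bar R) :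
  (m `]-oo, x]%classic < t)%E -> exists2 y, x < y & (m `]-oo, y]%classic < t)%E.
Proof.
move=> mt.
pose E (n : nat) : set (measurableTypeR R) := `]-oo, x + n.+1%:R^-1]%classic.
have : m \o E @ \oo --> m (\bigcap_n E n).
  apply: nonincreasing_cvg_mu.
  - rewrite (le_lt_trans (probability_le1 _ _)) ?ltry//.
    exact: measurable_itv.
  - by move=> n; exact: measurable_itv.
  - by apply: bigcap_measurable => // n _; exact: measurable_itv.
  - apply/nonincreasing_seqP => n; apply/subsetPset => y.
    rewrite /E /= !in_itv/= => /le_trans.
    by apply; rewrite lerD2l lef_pV2 ?posrE// ler_nat.
have -> : \bigcap_n E n = `]-oo, x]%classic.
  apply/seteqP; split => y /=; last first.
    by rewrite in_itv/= => yx n _; rewrite /E/= in_itv/= (le_trans yx)// lerDl.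
  move=> h; rewrite in_itv/=; apply/ler_addgt0Pr => e e0.
  have := h (Num.truncn e^-1) I; rewrite /E/= in_itv/= => /le_trans; apply.
  rewrite lerD2l -[leRHS]invrK lef_pV2 ?posrE ?invr_gt0//.
  exact/ltW/truncnS_gt.
move=> /(_ _ (open_ereal_lt' mt))[n _ /(_ n (leqnn n)) h].
exists (x + n.+1%:R^-1) => //; by rewrite ltrDl invr_gt0.
Qed.
End unit_measure.

Section quantiles.
Variables (R : realType) (m : probability (measurableTypeR R) R).

Let mray (x : R) : measurable (`]-oo, x]%classic : set (measurableTypeR R)).
Proof. exact: measurable_itv. Qed.

Let F (x : R) : \bar R := m `]-oo, x]%classic.

Let F_nd (x y : R) : x <= y -> (F x <= F y)%E.
Proof.
move=> xy; apply: le_measure; rewrite ?inE//; try exact: mray.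
by move=> z /=; rewrite !in_itv/= => /le_trans; apply.
Qed.

(** [g] is the generalized inverse of the distribution function [F], governed by [gP]: for [x] in
    [[0, c[], [x < g t] exactly when [F x < t]. An atom at [0] or at [c] becomes a stretch on which
    [g] is constant. *)
Lemma bounded_quantile (c : R) : 0 < c -> m `[0, c]%classic = 1%E ->
  exists g : R -> R, [/\ {homo g : x y / x <= y}, forall t, 0 <= g t <= c,
    forall A, measurable A -> unit_leb (g @^-1` A) = m A,
    forall t, (t%:E <= m [set 0%R])%E -> g t = 0 &
    forall t, (1 - m [set c] < t%:E)%E -> g t = c].
Proof.
move=> c0 m1.
have mI : measurable (`[0, c]%classic : set (measurableTypeR R)).
  exact: measurable_itv.
have mNI : m (~` `[0, c]) = 0%E by rewrite probability_setC// m1 subee.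
have m0 (A : set (measurableTypeR R)) :
    measurable A -> A `<=` ~` `[0, c] -> m A = 0%E.
  move=> mA Ac; apply/eqP; rewrite eq_le measure_ge0 andbT -mNI.
  by apply: le_measure; rewrite ?inE//; exact: measurableC.
(* Adding [0] and cutting at [c] makes every [S t] nonempty and bounded, so the supremum makes sense
   for all real [t], also outside [[0, 1]]. *)
pose S t : set R := 0 |` [set x | 0 <= x <= c /\ (F x < t%:E)%E].
have Sub t : ubound (S t) c.
  by move=> x [->|[/andP[_ xc]]]; rewrite ?(ltW c0).
have hS t : has_sup (S t) by split; [exists 0; left|exists c].
pose g t := sup (S t).
have g_ge0 t : 0 <= g t by apply: ub_le_sup; [exists c|left].
have g_le t : g t <= c by apply: ge_sup => //; exists 0; left.
have gP t x : 0 <= x < c -> (x < g t) = (F x < t%:E)%E.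
  move=> /andP[x0 xc]; apply/idP/idP => [xg|Fx].
    have [y [->|[_ Fy]] xy] := sup_gt (hS t).1 xg.
      by rewrite ltNge x0 in xy.
    by apply: le_lt_trans Fy; exact/F_nd/ltW.
  (* Right continuity gives a point strictly beyond [x]; it is cut at [c] to stay in [S t]. *)
  have [y xy Fy] := ray_right_lt Fx.
  apply: (@lt_le_trans _ _ (Num.min y c)); first by rewrite lt_min xy.
  apply: ub_le_sup; first by exists c.
  right; rewrite /= ge_min lexx orbT le_min (ltW c0) (le_trans x0 (ltW xy)).
  by split=> //; apply: le_lt_trans Fy; apply: F_nd; rewrite ge_min lexx.
have g_nd : {homo g : x y / x <= y}.
  move=> s t st; apply: ge_sup; first by exists 0; left.
  move=> x Sx; apply: ub_le_sup; first by exists c.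
  case: Sx => [->|[xc Fx]]; [by left|right; split=> //].
  by apply: lt_le_trans Fx _; rewrite lee_fin.
have mg : measurable_fun setT (g : measurableTypeR R -> measurableTypeR R).
  by apply: nondecreasing_measurable.
exists g; split=> //.
- by move=> t; rewrite g_ge0 g_le.
- pose G : {mfun (measurableTypeR R) >-> (measurableTypeR R)} :=
    HB.pack (g : measurableTypeR R -> measurableTypeR R)
      (@isMeasurableFun.Build _ _ _ _
        (g : measurableTypeR R -> measurableTypeR R) mg).
  suff : forall A, measurable A -> distribution (@unit_leb R) G A = m A by [].
  apply: eq_rays_measure => x.
  rewrite [LHS](_ : _ = @unit_leb R (g @^-1` `]-oo, x]%classic))//.
  have [x0|x0] := ltP x 0.
    rewrite (m0 `]-oo, x]%classic) ?mray//; last first.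
      move=> y /=; rewrite !in_itv/= => yx; apply/negP.
      by rewrite negb_and -ltNge (le_lt_trans yx).
    rewrite [X in unit_leb X](_ : _ = set0) ?measure0//.
    apply/seteqP; split=> // y /=; rewrite in_itv/= => gx.
    by move: (le_lt_trans gx x0); rewrite ltNge g_ge0.
  have [cx|xc] := leP c x.
    transitivity (1%:E : \bar R).
      rewrite -(probability_setT (@unit_leb R)); congr unit_leb.
      by apply/seteqP; split=> // y _ /=; rewrite in_itv/= (le_trans (g_le y)).
    apply/eqP; rewrite eq_le probability_le1 ?mray// andbT -m1.
    apply: le_measure; rewrite ?inE//.
    by move=> y /=; rewrite !in_itv/= => /andP[_ /le_trans]; apply.
  have Ff : F x = (fine (F x))%:E.
    by rewrite fineK// fin_num_measure//; exact: mray.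
  rewrite -/(F x) Ff -unit_leb_ocitv; last first.
    rewrite -!lee_fin -Ff; apply/andP; split; first exact: measure_ge0.
    by apply: probability_le1; exact: mray.
  (* By [gP], [g t <= x] means [t <= F x]: the preimage of the ray ending at [x] is the ray ending
     at [F x]. *)
  congr unit_leb; apply/seteqP; split => t /=;
    by rewrite !in_itv/= !leNgt gP ?x0// Ff lte_fin.
- move=> t tm; apply/eqP; rewrite eq_le g_ge0 andbT leNgt gP ?lexx// -leNgt.
  apply: (le_trans tm); apply: le_measure; rewrite ?inE//.
  by move=> y ->; rewrite /= in_itv/=.
- move=> t tm; apply/eqP; rewrite eq_le g_le/= leNgt; apply/negP => gc.
  (* [gP] is applied at the point [g t] itself: the ray ending there misses [c], so its mass is at
     most [1 - m [set c]], which is less than [t]. *)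
  have : (g t < g t); last by rewrite ltxx.
  rewrite gP ?g_ge0//; apply: le_lt_trans tm.
  rewrite -probability_setC//; apply: le_measure; rewrite ?inE//.
    exact: measurableC.
  by move=> y; rewrite /= in_itv/= => yg ye; move: gc; rewrite -ye ltNge yg.
Qed.

(** [a] is the infimum of the points where [F] has reached [k], attained by right continuity. The
    limits [1] and [0] of [F] at the two ends make this set nonempty and bounded below. *)
Lemma ray_quantile (k : R) : 0 < k < 1 ->
  exists a, (k%:E <= m `]-oo, a]%classic)%E /\
    forall x, x < a -> (m `]-oo, x]%classic < k%:E)%E.
Proof.
move=> /andP[k0 k1].
pose S : set R := [set x | (k%:E <= F x)%E].
have S0 : S !=set0.
  have : m \o (fun n : nat => `]-oo, n%:R]%classic :
      set (measurableTypeR R)) @ \oo --> m (\bigcup_n `]-oo, n%:R]%classic).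
    apply: nondecreasing_cvg_mu.
    - by move=> n; exact: mray.
    - by apply: bigcup_measurable => // n _; exact: mray.
    - apply/nondecreasing_seqP => n; apply/subsetPset => y /=.
      by rewrite !in_itv/= => /le_trans; apply; rewrite ler_nat.
  rewrite (_ : \bigcup_n _ = setT); last first.
    apply/seteqP; split => // x _; exists (Num.truncn `|x|).+1 => //=.
    by rewrite in_itv/= ltW// (le_lt_trans (ler_norm x))// truncnS_gt.
  rewrite probability_setT => /(_ [set y | (k%:E < y)%E])[].
    by apply: open_ereal_gt'; rewrite lte_fin.
  by move=> n _ /(_ n (leqnn n)) /ltW; exists n%:R.
have [l Fl] : exists l, (F l < k%:E)%E.
  have : m \o (fun n : nat => `]-oo, - n%:R]%classic :
      set (measurableTypeR R)) @ \oo --> m (\bigcap_n `]-oo, - n%:R]%classic).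
    apply: nonincreasing_cvg_mu.
    - by rewrite (le_lt_trans (probability_le1 _ _)) ?ltry//; exact: mray.
    - by move=> n; exact: mray.
    - by apply: bigcap_measurable => // n _; exact: mray.
    - apply/nonincreasing_seqP => n; apply/subsetPset => y /=.
      by rewrite !in_itv/= => /le_trans; apply; rewrite lerN2 ler_nat.
  rewrite (_ : \bigcap_n _ = set0); last first.
    apply/seteqP; split => // x /(_ (Num.truncn `|x|).+1 I) /=.
    rewrite in_itv/= lerNr leNgt => /negP; apply.
    by rewrite (le_lt_trans _ (truncnS_gt _))// -normrN ler_norm.
  rewrite measure0 => /(_ [set y | (y < k%:E)%E])[].
    by apply: open_ereal_lt'; rewrite lte_fin.
  by move=> n _ /(_ n (leqnn n)) h; exists (- n%:R).
have hS : has_inf S.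
  split=> //; exists l => x Sx; rewrite leNgt; apply/negP => xl.
  by have := le_lt_trans (F_nd (ltW xl)) Fl; rewrite ltNge Sx.
exists (inf S); split.
  rewrite leNgt; apply/negP => /ray_right_lt[y iy Fy].
  have [z Sz zy] := inf_lt hS.1 iy.
  by have := le_lt_trans (F_nd (ltW zy)) Fy; rewrite ltNge Sz.
move=> x xi; rewrite ltNge; apply/negP => Sx.
by have := ge_inf hS.2 Sx; rewrite leNgt xi.
Qed.

End quantiles.

(** * Cluster points of monotone functions *)

(** An ultrafilter finer than the filter at infinity replaces the extraction of subsequences: by
    compactness of [[0, c]] it gives a limit at every [t] at once, and finitely many points are
    treated by intersecting its members. *)
Lemma bounded_cluster_fun (R : realType) (c : R) (g_ : nat -> R -> R) :
  (forall n t, 0 <= g_ n t <= c) ->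
  exists g : R -> R, forall (s : seq R) (e : R) (N : nat), 0 < e ->
    exists2 n, (N <= n)%N & {in s, forall t, `|g_ n t - g t| < e}.
Proof.
move=> g_c; have [U [UU ooU]] := @ultraFilterLemma nat \oo _.
have lim_g t : exists l, forall e, 0 < e -> U [set n | `|g_ n t - l| < e].
  have [l [_ cl]] := @segment_compact R 0 c ((g_ ^~ t) @ U) _
    (@filterS _ U _ setT _ (fun n _ => g_c n t) filterT).
  exists l => e e0.
  (* Along an ultrafilter a cluster point is a limit: otherwise the complementary set would be a
     member and keep the values away from [l]. *)
  have [//|UN] := in_ultra_setVsetC [set n | `|g_ n t - l| < e] UU.
  have /cl : ((g_ ^~ t) @ U) (~` ball l e).
    by apply: (@filterS _ U) UN => n /= gl lg; apply: gl; rewrite distrC.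
  by move=> /(_ _ (nbhsx_ballx l e e0))[x []].
have [g gP] := choice lim_g.
exists g => s e N e0.
have Us : U [set n | {in s, forall t, `|g_ n t - g t| < e}].
  elim: s => [|t s IH]; first by apply: filterS filterT => n _ t.
  apply: filterS2 (gP t e e0) IH => n /= gt gs u.
  rewrite inE => /orP[/eqP->//|].
  exact: gs.
have UN : U [set n | (N <= n)%N] by apply: ooU; exact: nbhs_infty_ge.
by have [n [/= ns Nn]] := filter_ex (filterI Us UN); exists n.
Qed.

Lemma bounded_cluster_fun_nd (R : realType) (g_ : nat -> R -> R) (g : R -> R) :
  (forall n, {homo g_ n : x y / x <= y}) ->
  (forall (s : seq R) (e : R) (N : nat), 0 < e ->
    exists2 n, (N <= n)%N & {in s, forall t, `|g_ n t - g t| < e}) ->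
  {homo g : x y / x <= y}.
Proof.
move=> g_nd gP x y xy; apply/ler_addgt0Pr => e e0.
have [n _ h] := gP [:: x; y] (e / 2) 0 (divr_gt0 e0 (ltr0n _ 2)).
have := h x; have := h y; rewrite !inE !eqxx orbT => /(_ isT) + /(_ isT).
rewrite !ltr_norml => /andP[? ?] /andP[? ?].
have := g_nd n _ _ xy; lra.
Qed.

Lemma cluster_fun_cst (R : realType) (g_ : nat -> R -> R) (g : R -> R)
    (t v : R) :
  (forall (s : seq R) (e : R) (N : nat), 0 < e ->
    exists2 n, (N <= n)%N & {in s, forall t, `|g_ n t - g t| < e}) ->
  (forall n, g_ n t = v) -> g t = v.
Proof.
move=> gP gv; apply/eqP; rewrite eq_sym -subr_eq0 -normr_le0.
apply/ler_addgt0Pr => e e0; rewrite add0r.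
have [n _ h] := gP [:: t] e 0 e0.
by have := h t; rewrite inE eqxx gv => /(_ isT)/ltW.
Qed.

(** Monotonicity squeezes [g] and [h] between their values at the ends of a grid cell, so closeness
    at the ends spreads over every cell on which [g] moves little. *)
Lemma nondecreasing_close (R : realType) (g h : R -> R) (c e : R) (M : nat) :
  {homo g : x y / x <= y} -> {homo h : x y / x <= y} ->
  (forall t, 0 <= g t <= c) -> 0 < e -> c < M.+1%:R * e ^+ 2 ->
  {in [seq i%:R / M.+1%:R | i <- iota 0 M.+2], forall t, `|h t - g t| < e} ->
  (1 - e%:E <= unit_leb [set t | (`|h t - g t| <= 2 * e)%R])%E.
Proof.
move=> g_nd h_nd g_c e0 cM hg.
pose x (i : nat) : R := i%:R / M.+1%:R.
have M0 : 0 < M.+1%:R :> R by [].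
have x_nd i : x i <= x i.+1 by rewrite ler_pM2r ?invr_gt0// ler_nat.
have hgx i : (i <= M.+1)%N -> `|h (x i) - g (x i)| < e.
  by move=> iM; apply: hg; apply: map_f; rewrite mem_iota.
have mg : measurable_fun setT (g : measurableTypeR R -> measurableTypeR R).
  exact: nondecreasing_measurable.
have mh : measurable_fun setT (h : measurableTypeR R -> measurableTypeR R).
  exact: nondecreasing_measurable.
pose G : set (measurableTypeR R) := [set t | `|h t - g t| <= 2 * e].
have mG : measurable G.
  have : measurable_fun setT
      (fun t : measurableTypeR R => `|h t - g t| : measurableTypeR R).
    by apply: measurableT_comp => //; exact: measurable_funB.
  move=> /(_ measurableT `]-oo, 2 * e]%classic (measurable_itv _)).
  rewrite setTI [X in measurable X](_ : _ = G)//.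
(* [B i] is the [i]-th cell of the grid when [g] jumps by more than [e] on it.
   The jumps add up to at most [c], so these cells have measure at most
   [c / (e * M.+1) < e]; on the other cells [g] and [h] are [2 * e]-close. *)
pose B (i : nat) : set (measurableTypeR R) :=
  if e < g (x i.+1) - g (x i) then `[x i, x i.+1[%classic else set0.
have mB i : measurable (B i) by rewrite /B; case: ifP.
have GB : ~` G `&` `[0, 1[ `<=` \big[setU/set0]_(i < M.+1) B i.
  move=> t [Gt]; rewrite /= in_itv/= => /andP[t0 t1].
  have [i iM /andP[it ti]] : exists2 i, (i < M.+1)%N & x i <= t < x i.+1.
    exists (Num.truncn (t * M.+1%:R)).
      rewrite truncn_lt_nat ?mulr_ge0 ?ler0n// gtr_pMl//.
    rewrite /x ler_pdivrMr// ltr_pdivlMr//.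
    by apply: truncn_itv; rewrite mulr_ge0 ?ler0n.
  rewrite -bigcup_mkord; exists i => //; rewrite /B.
  case: ltP => [_|good]; first by rewrite /= in_itv/= it ti.
  exfalso; apply: Gt; rewrite /G /=.
  have := hgx i (ltnW iM); have := hgx i.+1 iM.
  rewrite !ltr_norml => /andP[? ?] /andP[? ?].
  have ? := g_nd _ _ it; have ? := g_nd _ _ (ltW ti).
  have ? := h_nd _ _ it; have ? := h_nd _ _ (ltW ti).
  by rewrite ler_norml; apply/andP; split; lra.
(* A cell has length [1 / M.+1], and a jump above [e] makes the factor [jump / e] at least [1]; for
   the other cells the bound is merely nonnegative. *)
have BE i : (i < M.+1)%N ->
    (unit_leb (B i) <= ((g (x i.+1) - g (x i)) / e / M.+1%:R)%:E)%E.
  move=> iM; rewrite /B; case: ltP => [bad|good].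
    apply: (@le_trans _ _ (lebesgue_measure `[x i, x i.+1[%classic)).
      rewrite unit_lebE; apply: le_measure; rewrite ?inE//.
        exact: measurableI.
    rewrite lebesgue_measure_itv/= lte_fin.
    have -> : (x i < x i.+1) by rewrite /x ltr_pM2r ?invr_gt0// ltr_nat.
    rewrite -EFinB lee_fin /x -mulrBl -natrB// subSnn ler_pM2r ?invr_gt0//.
    by rewrite ler_pdivlMr// mul1r ltW.
  rewrite measure0 lee_fin !divr_ge0// ?(ltW e0)// ?subr_ge0; exact: g_nd.
have : (unit_leb (~` G) <= e%:E)%E.
  rewrite -unit_leb_setI.
  have mGI : measurable (~` G `&` (`[0, 1[%classic : set (measurableTypeR R))).
    by apply: measurableI => //; exact: measurableC.
  apply: (le_trans (content_subadditive _ (fun i _ => mB i) mGI GB)).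
  apply: (@le_trans _ _
    (\sum_(i < M.+1) ((g (x i.+1) - g (x i)) / e / M.+1%:R)%:E)%E).
    by apply: lee_sum => i _; exact: BE.
  rewrite sumEFin lee_fin -!mulr_suml.
  rewrite -(big_mkord xpredT (fun i => g (x i.+1) - g (x i))) telescope_sumr//.
  rewrite ler_pdivrMr// ler_pdivrMr// -mulrA [_ * e]mulrC mulrA -expr2.
  rewrite mulrC; apply: le_trans (ltW cM).
  have /andP[_] := g_c (x M.+1); have /andP[+ _] := g_c (x 0); lra.
have := probability_setC (@unit_leb R) mG.
rewrite -/G => -> ; rewrite !leeBlDr ?fin_num_measure// => h1.
by rewrite addeC.
Qed.

(** * Box distance between laws on the line *)

Lemma probability_setI_full d (T : measurableType d) (R : realType)
    (P : probability T R) (A B : set T) :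
  measurable A -> measurable B -> P B = 1%E -> P (A `&` B) = P A.
Proof.
move=> mA mB B1.
have mAB : measurable (A `&` B) by exact: measurableI.
have mBc : measurable (~` B) by exact: measurableC.
have Bc : P (~` B) = 0%E by rewrite probability_setC// B1 subee.
apply/eqP; rewrite eq_le; apply/andP; split.
  by apply: le_measure; rewrite ?inE//; exact: subIsetl.
rewrite -(measureU0 mAB mBc Bc); apply: le_measure; rewrite ?inE//.
  exact: measurableU.
by move=> x Ax; have [Bx|Bx] := pselect (B x); [left|right].
Qed.

Section box_dist_line.
Variables (R : realType).

Lemma line_parameter (m : probability (measurableTypeR R) R) (g : R -> R) :
  measurable_fun setT (g : measurableTypeR R -> measurableTypeR R) ->
  (forall A, measurable A -> unit_leb (g @^-1` A) = m A) ->
  parameter (@line_space_proj R m \o g).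
Proof.
move=> mg gm.
have mp := @measurable_line_space_proj R m.
split.
  by apply: measurable_funTS; exact: (measurableT_comp mp mg).
move=> A mA; rewrite -unit_lebE line_space_mu -gm//.
rewrite -[X in measurable X]setTI; exact: mp.
Qed.

(** The quantile functions serve as parameters. Where they are [d]-close, mutual distances differ by
    at most [2 * d]. *)
Lemma box_dist_line (m1 m2 : probability (measurableTypeR R) R) (g1 g2 : R -> R)
    (e d : R) :
  {homo g1 : x y / x <= y} -> {homo g2 : x y / x <= y} ->
  (forall A, measurable A -> unit_leb (g1 @^-1` A) = m1 A) ->
  (forall A, measurable A -> unit_leb (g2 @^-1` A) = m2 A) ->
  0 <= e -> d * 2 <= e ->
  ((1 - e)%:E <= unit_leb [set t | (`|g2 t - g1 t| <= d)%R])%E ->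
  (box_dist (line_space m1) (line_space m2) <= e%:E)%E.
Proof.
move=> nd1 nd2 gm1 gm2 e0 de eG.
have mg1 : measurable_fun setT (g1 : measurableTypeR R -> measurableTypeR R).
  exact: nondecreasing_measurable.
have mg2 : measurable_fun setT (g2 : measurableTypeR R -> measurableTypeR R).
  exact: nondecreasing_measurable.
pose G : set (measurableTypeR R) := [set t | `|g2 t - g1 t| <= d].
have mG : measurable G.
  have : measurable_fun setT
      (fun t : measurableTypeR R => `|g2 t - g1 t| : measurableTypeR R).
    by apply: measurableT_comp => //; exact: measurable_funB.
  move=> /(_ measurableT `]-oo, d]%classic (measurable_itv _)).
  by rewrite setTI [X in measurable X](_ : _ = G).
have mS (m : probability (measurableTypeR R) R) (g : R -> R) :
    measurable_fun setT (g : measurableTypeR R -> measurableTypeR R) ->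
    measurable (g @^-1` line_supp m : set (measurableTypeR R)).
  move=> mg; rewrite -[X in measurable X]setTI; apply: mg => //.
  exact: measurable_line_supp.
apply: ereal_inf_lbound; exists e => //; split=> //.
exists (@line_space_proj R m1 \o g1), (@line_space_proj R m2 \o g2).
split; [exact: line_parameter|exact: line_parameter|].
(* Off the support [line_space_proj] forgets the point, so the set is restricted to where both
   functions take values in the supports, at no cost in measure. *)
pose A : set (measurableTypeR R) :=
  G `&` g1 @^-1` line_supp m1 `&` g2 @^-1` line_supp m2.
have mA : measurable A by do 2?apply: measurableI => //; exact: mS.
pose I : set (measurableTypeR R) := `[0, 1[%classic.
have mI : measurable I by exact: measurable_itv.
exists (I `&` A); split.
- exact: (measurableI I A mI mA).
- exact: subIsetl.
- rewrite -unit_lebE /A !probability_setI_full//; try exact: mS.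
  + by rewrite -(line_supp1 m1); apply: gm1; exact: measurable_line_supp.
  + by apply: measurableI => //; exact: mS.
  + by rewrite -(line_supp1 m2); apply: gm2; exact: measurable_line_supp.
move=> s t [_ [[Gs s1] s2]] [_ [[Gt t1] t2]].
rewrite !line_space_mdist /= !line_space_projE//.
rewrite (le_trans (ler_dist_dist _ _))//.
move: Gs Gt; rewrite /G /= !ler_norml => /andP[? ?] /andP[? ?].
by apply/andP; split; lra.
Qed.
End box_dist_line.

(** * Lipschitz observables and their laws *)

Section lipschitz_borel.
Variable R : realType.

Lemma lipschitz1_open (T U : metricType R) (f : T -> U) :
  lipschitz1 f -> forall V, open V -> open (f @^-1` V).
Proof.
move=> f1 V oV; rewrite openE => x /= Vfx.
have /nbhs_ballP[e /= e0 eV] : nbhs (f x) V by exact: open_nbhs_nbhs.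
apply/nbhs_ballP; exists e => //= y; rewrite ballEmdist/= => xy.
by apply: eV; rewrite ballEmdist/=; exact: le_lt_trans (f1 x y) xy.
Qed.

Lemma lipschitz1_measurable (X : mmSpace R) (f : X -> R^o) :
  lipschitz1 f -> measurable_fun setT (f : borelType X -> measurableTypeR R).
Proof.
move=> f1.
apply: (@measurability _ _ (borelType X) (measurableTypeR R) setT f
  (@RGenOpens.G R)).
  exact: RGenOpens.measurableE.
move=> _ [_ [a [b ->]] <-]; rewrite setTI; apply: sub_sigma_algebra.
apply: (@lipschitz1_open X R^o) => //; exact: interval_open.
Qed.

Definition lip_rv (X : mmSpace R) (f : X -> R^o) (f1 : lipschitz1 f) :
    {mfun (borelType X) >-> (measurableTypeR R)} :=
  HB.pack (f : borelType X -> measurableTypeR R)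
    (@isMeasurableFun.Build _ _ _ _ (f : borelType X -> measurableTypeR R)
      (lipschitz1_measurable f1)).

Definition lip_law (X : mmSpace R) (f : X -> R^o) (f1 : lipschitz1 f) :
  probability (measurableTypeR R) R := distribution (mm_mu X) (lip_rv f1).

Lemma lip_lawE (X : mmSpace R) (f : X -> R^o) (f1 : lipschitz1 f) A :
  lip_law f1 A = mm_mu X (f @^-1` A).
Proof. by []. Qed.

(** As [X] has full support, [f] takes values in the support of its law everywhere and not just
    almost everywhere, so it is 1-Lipschitz as a map into [line_space]. *)
Lemma dominated_line_space (X : mmSpace R) (f : X -> R^o) (f1 : lipschitz1 f) :
  dominated (line_space (lip_law f1)) X.
Proof.
pose F := @line_space_proj R (lip_law f1) \o f.
have fS x : line_supp (lip_law f1) (f x).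
  move=> U [oU Ux]; rewrite lip_lawE.
  have : supp (mm_mu X) x by rewrite mm_full_support.
  by apply; split=> //; exact: lipschitz1_open.
exists F; split.
  move=> x y; rewrite line_space_mdist /F/= !line_space_projE//.
  by rewrite distrC; exact: f1.
split; last by move=> A mA; rewrite line_space_mu.
exact: (measurableT_comp (@measurable_line_space_proj R (lip_law f1))
  (lipschitz1_measurable f1)).
Qed.
End lipschitz_borel.

(** * Observable diameter *)

Section limits.
Variable R : realType.
Local Open Scope ereal_scope.

Lemma nneg_cvge0P (u : nat -> \bar R) : (forall n, 0 <= u n) ->
  u @ \oo --> 0 <->
  (forall c : R, (0 < c)%R -> exists N, forall n, (N <= n)%N -> u n <= c%:E).
Proof.
move=> u0; split=> [u_0 c c0|h].
  have [N _ uN] := u_0 _ (open_ereal_lt' (c0 : 0 < c%:E)).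
  by exists N => n /uN /ltW.
move=> A A0.
have /nbhs_ballP[e /= e0 eA] : nbhs (0%R : R) (fun r => A r%:E) := A0.
have [N uN] := h (e / 2)%R (divr_gt0 e0 (ltr0n _ 2)).
exists N => // n /uN /=; have := u0 n; case: (u n) => [r| |//].
  rewrite !lee_fin => r0 re; apply: eA.
  by rewrite ball_itv/= in_itv/=; apply/andP; split; lra.
by rewrite leye_eq.
Qed.

Lemma limn_einf_gt0 (u : nat -> \bar R) : 0 < limn_einf u ->
  exists2 e : R, (0 < e)%R & exists N, forall n, (N <= n)%N -> e%:E <= u n.
Proof.
rewrite limn_einf_lim => /open_ereal_gt' u0.
have [N _ /(_ N (leqnn N)) uN] := @is_cvg_einfs R u _ u0.
have h n : (N <= n)%N -> einfs u N <= u n.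
  by move=> Nn; apply: ereal_inf_lbound; exists n.
move: uN h => /=; case: (einfs u N) => [e| |//] uN h.
- exists e; [by move: uN; rewrite lte_fin|by exists N].
(* When the tail infimum is infinite, any positive real is a bound. *)
- exists 1%R; [exact: ltr01|exists N => n /h].
  by rewrite leye_eq => /eqP ->; rewrite leey.
Qed.

(** This and the next lemma turn the limits defining the invariants of pyramids into a supremum and
    an infimum over [d > 0]. *)
Lemma lim_nonincreasing_at0 (F : R -> \bar R) :
  (forall x y, (0 < x)%R -> (x <= y)%R -> F y <= F x) ->
  lim (F d @[d --> 0^'+]) = ereal_sup [set F d | d in [set d | (0 < d)%R]].
Proof.
move=> Fni; apply/cvg_lim => //.
rewrite (_ : [set d : R | _] = [set` `]0%R, +oo[]).
  apply: nonincreasing_at_right_cvge => // x y.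
  rewrite !in_itv/= !andbT => x0 _.
  exact: Fni.
by apply/seteqP; split => x /=; rewrite in_itv/= andbT.
Qed.

Lemma lim_nondecreasing_at0 (F : R -> \bar R) :
  (forall x y, (0 < x)%R -> (x <= y)%R -> F x <= F y) ->
  lim (F d @[d --> 0^'+]) = ereal_inf [set F d | d in [set d | (0 < d)%R]].
Proof.
move=> Fni; apply/cvg_lim => //.
rewrite (_ : [set d : R | _] = [set` `]0%R, +oo[]).
  apply: nondecreasing_at_right_cvge => // x y.
  rewrite !in_itv/= !andbT => x0 _.
  exact: Fni.
by apply/seteqP; split => x /=; rewrite in_itv/= andbT.
Qed.

Lemma partial_diam_ge0 (T : metricType R) (nu : set T -> \bar R) a :
  0 <= partial_diam nu a.
Proof.
by apply: le_ereal_inf_tmp => _ [A _ <-]; apply: ereal_sup_ubound; left.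
Qed.

Lemma partial_diam_le (T : metricType R) (nu : set T -> \bar R) (a b : R) :
  (a <= b)%R -> partial_diam nu a <= partial_diam nu b.
Proof.
move=> ab; apply: le_ereal_inf_tmp => _ [A [bA bnu] <-].
apply: ereal_inf_lbound.
by exists A => //; split=> //; apply: le_trans bnu; rewrite lee_fin.
Qed.

Lemma obs_diam_nonincreasing (X : mmSpace R) (k l : R) : (k <= l)%R ->
  obs_diam X l <= obs_diam X k.
Proof.
move=> kl; apply: ge_ereal_sup => _ [f f1 <-].
apply: (le_trans (partial_diam_le _ (_ : 1 - l <= 1 - k)%R)).
  by rewrite lerD2l lerN2.
by apply: ereal_sup_ubound; exists f.
Qed.

Lemma obs_diam_ge0 (X : mmSpace R) (k : R) : 0 <= obs_diam X k.
Proof.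
apply: le_trans (partial_diam_ge0 _ _) _; last first.
  apply: ereal_sup_ubound; exists (fun=> 0%R) => //.
  by move=> x y; rewrite mdistxx mdist_ge0.
Qed.

Lemma pyr_obs_diamE (P : set (mmSpace R)) (k : R) : pyr_obs_diam P k =
  ereal_sup [set ereal_sup [set obs_diam X (k + d) | X in P]
    | d in [set d | (0 < d)%R]].
Proof.
apply: lim_nonincreasing_at0 => x y _ xy.
apply: ge_ereal_sup => _ [X PX <-].
apply: le_trans (obs_diam_nonincreasing _ _) _; last first.
  by apply: ereal_sup_ubound; exists X.
by rewrite lerD2l.
Qed.

Lemma pyr_obs_diam_ge0 (P : set (mmSpace R)) (k : R) : P !=set0 ->
  0 <= pyr_obs_diam P k.
Proof.
move=> [X PX]; rewrite pyr_obs_diamE.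
apply: le_trans (obs_diam_ge0 X (k + 1)) _.
apply: (@le_trans _ _ (ereal_sup [set obs_diam X (k + 1) | X in P])).
  by apply: ereal_sup_ubound; exists X.
by apply: ereal_sup_ubound; exists 1%R => //; exact: ltr01.
Qed.

Lemma pyr_obs_diam_gt (P : set (mmSpace R)) (k : R) (c : \bar R) :
  c < pyr_obs_diam P k -> exists2 X, P X & c < obs_diam X k.
Proof.
rewrite pyr_obs_diamE => /ereal_sup_gt[_ [d /= d0 <-]].
move=> /ereal_sup_gt[_ [X PX <-]] h.
exists X => //; apply: lt_le_trans h _; apply: obs_diam_nonincreasing.
by rewrite lerDl ltW.
Qed.

(** The inequality [k < l] is strict because the shift [l - k] plays the part of [d > 0]. *)
Lemma obs_diam_le_pyr (P : set (mmSpace R)) (X : mmSpace R) (k l : R) :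
  P X -> (k < l)%R -> obs_diam X l <= pyr_obs_diam P k.
Proof.
move=> PX kl; rewrite pyr_obs_diamE.
apply: (@le_trans _ _ (ereal_sup [set obs_diam X (k + (l - k)) | X in P])).
  by apply: ereal_sup_ubound; exists X; rewrite // addrC subrK.
by apply: ereal_sup_ubound; exists (l - k)%R => //=; rewrite subr_gt0.
Qed.

End limits.

(** * Extreme quantiles of an observable *)

Section observable.
Variable R : realType.

Lemma diam_le (T : metricType R) (A : set T) (c : R) : 0 <= c ->
  (forall x y, A x -> A y -> mdist x y <= c) -> (diam A <= c%:E)%E.
Proof.
move=> c0 Ac; apply: ge_ereal_sup => _ [->|[x Ax [y Ay <-]]].
  by rewrite lee_fin.
by rewrite lee_fin; exact: Ac.
Qed.

(** [partial_diam] speaks of Borel sets of [R^o], laws live on [measurableTypeR R]; both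
    sigma-algebras are generated by open intervals. *)
Lemma borel_measurable (A : set R) : @borel R^o A <->
  measurable (A : set (measurableTypeR R)).
Proof.
split.
  move=> bA; apply: bA; split.
    exact: sigma_algebra_measurable.
  by move=> B oB; exact: open_measurable.
rewrite RGenOpens.measurableE; apply: smallest_sub.
  exact: smallest_sigma_algebra.
move=> _ [a [b ->]]; apply: sub_sigma_algebra; exact: interval_open.
Qed.

(** [a] and [b] are the lower and upper [k / 2]-quantiles. Any slightly larger interval carries mass
    at least [1 - k], so its diameter exceeds [c]. *)
Lemma partial_diam_rays (m : probability (measurableTypeR R) R) (k c : R) :
  0 < k -> 0 <= c ->
  (c%:E < @partial_diam R R^o (m : set R -> \bar R) (1 - k))%E ->
  k < 1 /\ exists a b : R, [/\ c <= b - a,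
    ((k / 2)%:E <= m `]-oo, a]%classic)%E &
    ((k / 2)%:E <= m `[b, +oo[%classic)%E].
Proof.
move=> k0 c0 cm.
have k1 : k < 1.
  (* For [k >= 1] the empty set is admissible and has diameter [0]. *)
  rewrite ltNge; apply/negP => k1.
  have : (@partial_diam R R^o (m : set R -> \bar R) (1 - k) <= 0)%E.
    apply: (@le_trans _ _ (@diam R R^o set0)); last exact: diam_le.
    apply: ereal_inf_lbound; exists set0 => //; split.
      exact/borel_measurable.
    by rewrite measure0 lee_fin subr_le0.
  by rewrite leNgt (le_lt_trans _ cm)// lee_fin.
split=> //.
have k2 : 0 < k / 2 < 1 by apply/andP; split; lra.
have [a [ka aP]] := ray_quantile m k2.
(* The upper quantile is minus the lower quantile of the law reflected at [0]. *)
have mN : measurable_fun setT (-%R : measurableTypeR R -> measurableTypeR R).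
  by apply: nonincreasing_measurable => // x y; rewrite lerN2.
pose N : {mfun (measurableTypeR R) >-> (measurableTypeR R)} :=
  HB.pack (-%R : measurableTypeR R -> measurableTypeR R)
    (@isMeasurableFun.Build _ _ _ _
      (-%R : measurableTypeR R -> measurableTypeR R) mN).
have mNE x : distribution m N `]-oo, x]%classic = m `[- x, +oo[%classic.
  rewrite /distribution /pushforward; congr (m _); apply/seteqP.
  by split => y /=; rewrite !in_itv/= andbT lerNl.
have [b' [kb bP]] := ray_quantile (distribution m N) k2.
have {}kb : ((k / 2)%:E <= m `[(- b')%R, +oo[%classic)%E by rewrite -mNE.
have bP' x : x < b' -> (m `[(- x)%R, +oo[%classic < (k / 2)%:E)%E.
  by rewrite -mNE; exact: bP.
exists a, (- b'); split => //.
apply/ler_addgt0Pr => e e0.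
(* Stepping [e / 2] beyond the quantiles leaves less than [k / 2] on each side, by their
   minimality. *)
pose A : set (measurableTypeR R) := `](a - e / 2), (- b' + e / 2)[%classic.
have mA : measurable A by exact: measurable_itv.
have cA : (c%:E < @diam R R^o A)%E.
  apply: (lt_le_trans cm); apply: ereal_inf_lbound; exists A => //; split.
    exact/borel_measurable.
  have mAc : (m (~` A) <= k%:E)%E.
    apply: (@le_trans _ _
        (m (`]-oo, a - e / 2]%classic `|` `[- b' + e / 2, +oo[%classic))).
      apply: le_measure; rewrite ?inE; [exact: measurableC| |].
        by apply: measurableU; exact: measurable_itv.
      move=> x /= /negP; rewrite !in_itv/= negb_and -!leNgt andbT.
      by move=> /orP.
    apply: le_trans (measureU2 _ _ _) _; try exact: measurable_itv.
    have -> : k%:E = ((k / 2)%:E + (k / 2)%:E)%E by rewrite -EFinD -splitr.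
    apply: leeD; apply/ltW; first by apply: aP; lra.
    have -> : - b' + e / 2 = - (b' - e / 2) by lra.
    by apply: bP'; lra.
  have := probability_setC m mA => mAcE; rewrite mAcE in mAc.
  move: mAc; rewrite EFinB !leeBlDr ?fin_num_measure//.
  by rewrite addeC.
(* The length could be negative at this point, hence the maximum with [0]. *)
have : (@diam R R^o A <= (Num.max 0 (- b' - a + e))%:E)%E.
  apply: diam_le; first by rewrite le_max lexx.
  move=> x y; rewrite /A/= !in_itv/= => /andP[? ?] /andP[? ?].
  rewrite le_max; apply/orP; right.
  rewrite /mdist/=; rewrite ler_norml; apply/andP; split; lra.
move=> /(lt_le_trans cA); rewrite lte_fin lt_max ltNge c0/=.
by move/ltW.
Qed.

(** A large observable diameter is recorded by a law on [[0, c]] that [X] dominates, with mass at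
    least [k / 2] at each end; in terms of [g] this fixes two values that survive pointwise
    limits. *)
Lemma obs_diam_line (X : mmSpace R) (k c : R) : 0 < k -> 0 < c ->
  (c%:E < obs_diam X k)%E ->
  [/\ k < 1 & exists (m : probability (measurableTypeR R) R) (g : R -> R),
    [/\ dominated (line_space m) X, {homo g : x y / x <= y},
      forall t, 0 <= g t <= c,
      forall A, measurable A -> unit_leb (g @^-1` A) = m A &
      g (k / 2) = 0 /\ g (1 - k / 4) = c]].
Proof.
move=> k0 c0 /ereal_sup_gt[_ [f f1 <-]] cf.
have [k1 [a [b [cab ka kb]]]] :=
  @partial_diam_rays (lip_law f1) k c k0 (ltW c0) cf.
split=> //.
(* [u] is [0] where [f <= a] and [c] where [f >= b], since [b - a >= c]. *)
pose u x : R^o := Num.min (Num.max (f x - a) 0) c.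
have u_le x y : u x <= u y + mdist x y.
  have d0 := mdist_ge0 x y; have := f1 x y.
  rewrite {1}/mdist/= distrC => /(le_trans (ler_norm _)) fxy.
  rewrite /u !maxEle !minEle.
  by do ! [case: ifPn => /=]; rewrite -?ltNge => *; lra.
have u1 : lipschitz1 u.
  move=> x y; rewrite {1}/mdist/= ler_norml.
  have := u_le x y; have := u_le y x; rewrite [mdist y x]metric_sym => ? ?.
  by apply/andP; split; lra.
have u_c x : 0 <= u x <= c.
  by rewrite /u ge_min lexx orbT le_min le_max lexx orbT (ltW c0).
have mI (i : interval R) : measurable ([set` i] : set (measurableTypeR R)).
  exact: measurable_itv.
have mf (A : set R) : measurable (A : set (measurableTypeR R)) ->
    measurable (f @^-1` A : set (borelType X)).
  move=> mA; rewrite -[X in measurable X]setTI.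
  exact: (lipschitz1_measurable f1).
have mu (A : set R) : measurable (A : set (measurableTypeR R)) ->
    measurable (u @^-1` A : set (borelType X)).
  move=> mA; rewrite -[X in measurable X]setTI.
  exact: (lipschitz1_measurable u1).
have uI : lip_law u1 `[0, c]%classic = 1%E.
  rewrite lip_lawE (_ : u @^-1` _ = setT); first exact: probability_setT.
  by apply/seteqP; split => // x _ /=; rewrite in_itv; exact: u_c.
have [g [g_nd g_c gm g0 gc]] := bounded_quantile c0 uI.
exists (lip_law u1), g; split=> //; first exact: dominated_line_space.
split.
  apply: g0; apply: (le_trans ka); rewrite !lip_lawE.
  apply: le_measure; rewrite ?inE.
  - exact: mf.
  - exact: mu.
  move=> x /=; rewrite in_itv/= /u => fa.
  by rewrite max_r ?min_l ?(ltW c0)// subr_le0.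
(* The clause of [bounded_quantile] for [c] asks for a strict inequality, whence [k / 4] instead of
   [k / 2]. *)
apply: gc; apply: (@le_lt_trans _ _ (1 - (k / 2)%:E)%E).
  apply: leeB => //; apply: (le_trans kb); rewrite !lip_lawE.
  apply: le_measure; rewrite ?inE.
  - exact: mf.
  - exact: mu.
  move=> x /=; rewrite in_itv/= andbT /u => fa.
  by rewrite min_r// le_max; apply/orP; left; lra.
by rewrite -EFinB lte_fin; lra.
Qed.

End observable.

(** * From weak convergence to observable diameters *)

Section weak_to_obs.
Variable R : realType.

Lemma mm_iso_point (X : mmSpace R) (x y : X) : mm_iso X (one_point R) -> x = y.
Proof.
by move=> [f [/bij_inj fi _ _]]; apply: fi; case: (f x); case: (f y).
Qed.

Lemma weakly_converges_obs_diam (P : nat -> set (mmSpace R)) (k : R) :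
  (forall n, pyramid (P n)) ->
  weakly_converges P (pyramid_point R) -> 0 < k ->
  pyr_obs_diam (P n) k @[n --> \oo] --> 0%E.
Proof.
move=> hP [_ wP] k0.
apply/nneg_cvge0P => [n|c c0].
  by apply: pyr_obs_diam_ge0; exact: pyramid_nonempty (hP n).
apply: contrapT => /forallNP far.
have {}far N : exists n, (N <= n)%N /\ (c%:E < pyr_obs_diam (P n) k)%E.
  have /existsNP[n /not_implyP[Nn /negP]] := far N.
  by rewrite -ltNge; exists n.
have k1 : k < 1.
  have [n [_ /pyr_obs_diam_gt[X _ cX]]] := far 0.
  by have [] := obs_diam_line k0 c0 cX.
(* [w N] collects an index beyond [N], a law whose space belongs to the pyramid of that index, and
   the quantile function of the law. *)
have {far} /choice[w wP'] : forall N,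
    exists w : nat * probability (measurableTypeR R) R * (R -> R),
    [/\ (N <= w.1.1)%N, P w.1.1 (line_space w.1.2) &
      [/\ {homo w.2 : x y / x <= y}, forall t, 0 <= w.2 t <= c,
        forall A, measurable A -> unit_leb (w.2 @^-1` A) = w.1.2 A,
        w.2 (k / 2) = 0 & w.2 (1 - k / 4) = c]].
  move=> N; have [n [Nn /pyr_obs_diam_gt[X PX cX]]] := far N.
  have [_ [m [g [dom g_nd g_c gm [g0 gc]]]]] := obs_diam_line k0 c0 cX.
  by exists (n, m, g); split=> //; exact: pyramid_down (hP n) _ _ PX dom.
pose g_ N := (w N).2.
have g_nd N : {homo g_ N : x y / x <= y}.
  by have [_ _ [h _ _ _ _]] := wP' N; exact: h.
have g_c N t : 0 <= g_ N t <= c by have [_ _ [_ h _ _ _]] := wP' N; exact: h.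
have [g gP] := bounded_cluster_fun g_c.
have gnd := bounded_cluster_fun_nd g_nd gP.
have gc t : 0 <= g t <= c.
  by apply/andP; split; apply/ler_addgt0Pr => e e0;
    have [n _ /(_ t)] := gP [:: t] e 0 e0;
    rewrite inE eqxx => /(_ isT); rewrite ltr_norml => /andP[? ?];
    have /andP[? ?] := g_c n t; lra.
have g0 : g (k / 2) = 0.
  by apply: (cluster_fun_cst gP) => n; have [_ _ [_ _ _ h _]] := wP' n.
have g1 : g (1 - k / 4) = c.
  by apply: (cluster_fun_cst gP) => n; have [_ _ [_ _ _ _ h]] := wP' n.
have mg : measurable_fun setT (g : measurableTypeR R -> measurableTypeR R).
  exact: nondecreasing_measurable.
pose G : {mfun (measurableTypeR R) >-> (measurableTypeR R)} :=
  HB.pack (g : measurableTypeR R -> measurableTypeR R)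
    (@isMeasurableFun.Build _ _ _ _
      (g : measurableTypeR R -> measurableTypeR R) mg).
pose m : probability (measurableTypeR R) R := distribution (@unit_leb R) G.
have gm A : measurable A -> unit_leb (g @^-1` A) = m A by [].
have mI (i : interval R) : measurable ([set` i] : set (measurableTypeR R)).
  exact: measurable_itv.
have mgA (A : set (measurableTypeR R)) : measurable A ->
    measurable (g @^-1` A : set (measurableTypeR R)).
  by move=> mA; rewrite -[X in measurable X]setTI; exact: (mg measurableT A mA).
(* [g] vanishes up to [k / 2], so its law has an atom at [0]. *)
have supp0 : line_supp m 0.
  move=> U [oU U0]; rewrite -gm; last exact: open_measurable.
  apply: (@lt_le_trans _ _ (unit_leb `]-oo, k / 2]%classic)).
    by rewrite unit_leb_ocitv ?lte_fin; [|apply/andP; split]; lra.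
  apply: le_measure; rewrite ?inE; [exact: mI| |].
    by apply: mgA; exact: open_measurable.
  move=> t /=; rewrite in_itv/= => /gnd; rewrite g0 => gt0.
  suff -> : g t = 0 by [].
  by apply/eqP; rewrite eq_le gt0; case/andP: (gc t).
(* [g] equals [c] beyond [1 - k / 4], a set of measure [k / 4]. *)
have suppc : line_supp m c.
  move=> U [oU Uc]; rewrite -gm; last exact: open_measurable.
  apply: (@lt_le_trans _ _ (unit_leb (~` `]-oo, 1 - k / 4]%classic))).
    rewrite probability_setC; last exact: mI.
    rewrite [X in (_ - X)%E]unit_leb_ocitv; last by apply/andP; split; lra.
    by rewrite -EFinB lte_fin; lra.
  apply: le_measure; rewrite ?inE; [by apply: measurableC; exact: mI
    |by apply: mgA; exact: open_measurable|].
  move=> t /= /negP; rewrite in_itv/= -ltNge => /ltW/gnd; rewrite g1 => gtc.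
  suff -> : g t = c by [].
  by apply/eqP; rewrite eq_le gtc andbT; case/andP: (gc t).
have Yn : ~ pyramid_point R (line_space m).
  move=> /(mm_iso_point (line_space_proj m 0) (line_space_proj m c)).
  move=> /(congr1 (@line_space_val _ m)); rewrite !line_space_projE//.
  by move=> c0'; rewrite -c0' ltxx in c0.
have [e e0 [N uN]] := limn_einf_gt0 (wP _ Yn).
(* Closeness [d] on the grid gives [2 * d] off a set of measure [d], hence box distance at most
   [4 * d = e / 2], against the lower bound [e]. *)
pose d := e / 8.
have d0 : 0 < d by rewrite /d; lra.
pose M := Num.truncn (c / d ^+ 2).
have cM : c < M.+1%:R * d ^+ 2.
  by rewrite -ltr_pdivrMr ?exprn_gt0//; exact: truncnS_gt.
have [n Nn close] := gP [seq i%:R / M.+1%:R | i <- iota 0 M.+2] d N d0.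
have [nw Pn [_ _ gmn _ _]] := wP' n.
have := nondecreasing_close gnd (g_nd n) gc d0 cM close.
move=> /(le_trans (_ : (1 - (4 * d))%:E <= 1 - d%:E)%E) H.
have := @box_dist_line R m (w n).1.2 g (g_ n) (4 * d) (2 * d) gnd (g_nd n)
  gm gmn.
have d40 : 0 <= 4 * d by lra.
have d44 : 2 * d * 2 <= 4 * d by lra.
move=> /(_ d40 d44) K.
have {}K : (box_dist (line_space m) (line_space (w n).1.2) <= (4 * d)%:E)%E.
  by apply: K; apply: H; rewrite -EFinB lee_fin; lra.
have := uN (w n).1.1 (leq_trans Nn nw).
apply/negP; rewrite -ltNge; apply: (@le_lt_trans _ _ (4 * d)%:E); last first.
  by rewrite lte_fin /d; lra.
by apply: le_trans K; apply: ereal_inf_lbound; exists (line_space (w n).1.2).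
Qed.

End weak_to_obs.

(** * Separation distance *)

Section separation.
Variable R : realType.
Local Open Scope ereal_scope.

Lemma sep_dist_ge0 (X : mmSpace R) (a b : R) : 0 <= sep_dist X a b.
Proof. by apply: ereal_sup_ubound; left. Qed.

Lemma sep_dist_nonincreasing (X : mmSpace R) (a b a' b' : R) :
  (a <= a')%R -> (b <= b')%R -> sep_dist X a' b' <= sep_dist X a b.
Proof.
move=> aa bb; apply: ge_ereal_sup => _ [->|[A0 [A1 [m0 m1 h0 h1 ->]]]].
  exact: sep_dist_ge0.
apply: ereal_sup_ubound; right; exists A0, A1; split=> //.
  by apply: le_trans h0; rewrite lee_fin.
by apply: le_trans h1; rewrite lee_fin.
Qed.

Lemma pyr_sep_distE (P : set (mmSpace R)) (a b : R) : pyr_sep_dist P a b =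
  ereal_inf [set ereal_sup [set sep_dist X (a - d) (b - d) | X in P]
    | d in [set d | (0 < d)%R]].
Proof.
apply: lim_nondecreasing_at0 => x y _ xy; apply: ge_ereal_sup => _ [X PX <-].
apply: (@le_trans _ _ (sep_dist X (a - y) (b - y))).
  by apply: sep_dist_nonincreasing; rewrite lerD2l lerN2.
by apply: ereal_sup_ubound; exists X.
Qed.

(** Lowering both thresholds by [d] can only increase the separation distance. *)
Lemma pyr_sep_dist_ge (P : set (mmSpace R)) (X : mmSpace R) (a b : R) : P X ->
  sep_dist X a b <= pyr_sep_dist P a b.
Proof.
move=> PX; rewrite pyr_sep_distE; apply: le_ereal_inf_tmp => _ [d /= d0 <-].
apply: (@le_trans _ _ (sep_dist X (a - d) (b - d))).
  by apply: sep_dist_nonincreasing; rewrite gerBl ltW.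
by apply: ereal_sup_ubound; exists X.
Qed.

Lemma pyr_sep_dist_ge0 (P : set (mmSpace R)) (a b : R) : P !=set0 ->
  0 <= pyr_sep_dist P a b.
Proof.
by move=> [X PX]; apply: le_trans (pyr_sep_dist_ge a b PX); exact: sep_dist_ge0.
Qed.

Lemma probability_meet d (T : measurableType d) (mu : probability T R)
    (A B : set T) (a b : R) : measurable A -> measurable B ->
  a%:E <= mu A -> b%:E <= mu B -> (1 < a + b)%R -> A `&` B !=set0.
Proof.
move=> mA mB aA bB ab; apply/set0P/negP => /eqP AB.
have : mu (A `|` B) <= 1 by apply: probability_le1; exact: measurableU.
rewrite measureU// => h.
have : (a + b)%:E <= 1 by rewrite EFinD (le_trans _ h)// leeD.
by rewrite lee_fin leNgt ab.
Qed.

(** For [f] the distance to [A0], a set of values of mass at least [1 - k] has a preimage that meets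
    both [A0], where [f] is [0], and [A1], where [f] is at least the distance of the two sets. *)
Lemma sep_dist_le_obs_diam (X : mmSpace R) (a b k : R) :
  (0 < k)%R -> (k < a)%R -> (k < b)%R -> sep_dist X a b <= obs_diam X k.
Proof.
move=> k0 ka kb; apply: ge_ereal_sup => _ [->|[A0 [A1 [m0 m1 h0 h1 ->]]]].
  exact: obs_diam_ge0.
have nonempty (A : set (borelType X)) (l : R) :
    (k < l)%R -> l%:E <= mm_mu X A -> exists x : X, A x.
  move=> kl lA; suff /set0P[x Ax] : A != set0 by exists x.
  apply/negP => /eqP A00; move: lA; rewrite A00 measure0 lee_fin leNgt.
  by rewrite (lt_trans k0).
have [x0 Ax0] := nonempty _ _ ka h0.
have [x1 Ax1] := nonempty _ _ kb h1.
pose S (x : X) : set R := [set mdist y x | y in A0].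
have S0 x : has_inf (S x).
  split; first by exists (mdist x0 x); exists x0.
  by exists 0%R => _ [y _ <-]; exact: mdist_ge0.
pose f x : R^o := inf (S x).
have f_ge0 x : (0 <= f x)%R.
  by apply: lb_le_inf; [exact: (S0 x).1|move=> _ [y _ <-]; exact: mdist_ge0].
have f_le x y : (f x <= f y + mdist y x)%R.
  rewrite -lerBlDr; apply: lb_le_inf; first exact: (S0 y).1.
  move=> _ [z Az <-]; rewrite lerBlDr.
  apply: (@le_trans _ _ (mdist z x)).
    by apply: ge_inf; [exact: (S0 x).2|exists z].
  exact: metric_triangle.
have f1 : lipschitz1 f.
  move=> x y; rewrite {1}/mdist/= ler_norml.
  have := f_le x y; have := f_le y x; rewrite [mdist y x]metric_sym => ? ?.
  by apply/andP; split; lra.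
have f0 x : A0 x -> f x = 0%R.
  move=> Ax; apply/eqP; rewrite eq_le f_ge0 andbT -(mdistxx x).
  by apply: ge_inf; [exact: (S0 x).2|exists x].
(* Both sets have positive mass, so they are nonempty and their distance is finite. *)
have [r Dr] : exists r, @set_dist R X A0 A1 = r%:E.
  have : @set_dist R X A0 A1 <= (mdist x0 x1)%:E.
    by apply: ereal_inf_lbound; exists x0 => //; exists x1.
  have : 0 <= @set_dist R X A0 A1.
    apply: le_ereal_inf_tmp => _ [x _ [y _ <-]].
    by rewrite lee_fin mdist_ge0.
  by case: set_dist => // r _ _; exists r.
have fr x : A1 x -> (r <= f x)%R.
  move=> Ax; apply: lb_le_inf; first exact: (S0 x).1.
  move=> _ [y Ay <-]; rewrite -lee_fin -Dr.
  by apply: ereal_inf_lbound; exists y => //; exists x.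
rewrite Dr.
apply: (@le_trans _ _
  (@partial_diam R R^o (lip_law f1 : set R -> \bar R) (1 - k))); last first.
  by apply: ereal_sup_ubound; exists f.
apply: le_ereal_inf_tmp => _ [A [/borel_measurable bA kA] <-].
have mfA : measurable (f @^-1` A : set (borelType X)).
  by rewrite -[X in measurable X]setTI; exact: (lipschitz1_measurable f1).
have [y0 [Ay0 fy0]] : A0 `&` (f @^-1` A) !=set0.
  by apply: (@probability_meet _ _ (mm_mu X) _ _ a (1 - k)) => //; lra.
have [y1 [Ay1 fy1]] : A1 `&` (f @^-1` A) !=set0.
  by apply: (@probability_meet _ _ (mm_mu X) _ _ b (1 - k)) => //; lra.
apply: (@le_trans _ _ (mdist (f y0) (f y1))%:E).
  rewrite lee_fin f0// /mdist/= subr0; exact: le_trans (fr _ Ay1) (ler_norm _).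
by apply: ereal_sup_ubound; right; exists (f y0) => //; exists (f y1).
Qed.

Lemma obs_diam_levy (P : nat -> set (mmSpace R)) :
  (forall n, pyramid (P n)) ->
  (forall k : R, (0 < k)%R -> pyr_obs_diam (P n) k @[n --> \oo] --> 0) ->
  levy_family P.
Proof.
move=> hP oP a b a0 b0 _.
have Pn0 n := pyramid_nonempty (hP n).
(* The thresholds [a - k] and [b - k] are at least [3 * k]: this leaves room for the strict
   inequalities [2 * k < a - k], [2 * k < b - k] and [k < 2 * k]. *)
pose k := (Num.min a b / 4)%R.
have k0 : (0 < k)%R by rewrite /k divr_gt0// lt_min a0 b0.
have ka : (4 * k <= a)%R by rewrite /k mulrC divfK// ge_min lexx.
have kb : (4 * k <= b)%R by rewrite /k mulrC divfK// ge_min lexx orbT.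
apply/nneg_cvge0P => [n|c c0]; first exact: pyr_sep_dist_ge0.
have /nneg_cvge0P := oP k k0.
move=> /(_ (fun n => pyr_obs_diam_ge0 _ (Pn0 n)) c c0)[N NP]; exists N => n /NP.
apply: le_trans; rewrite pyr_sep_distE.
apply: (@le_trans _ _ (ereal_sup [set sep_dist X (a - k) (b - k) | X in P n])).
  by apply: ereal_inf_lbound; exists k.
apply: ge_ereal_sup => _ [X PX <-].
apply: (@le_trans _ _ (obs_diam X (2 * k))).
  by apply: sep_dist_le_obs_diam; lra.
by apply: obs_diam_le_pyr => //; lra.
Qed.

End separation.

(** * Spaces with a single point *)

Section point_space.
Variables (R : realType) (X : mmSpace R).
Hypothesis X1 : forall x y : X, x = y.

Let dichotomy (A : set X) : A = setT \/ A = set0.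
Proof.
have [Ap|Ap] := pselect (A point); [left|right]; apply/seteqP; split => // x.
  by rewrite (X1 x point).
by rewrite (X1 x point).
Qed.

(** With nonemptiness and closure under domination, this puts a one-point space in every pyramid. *)
Lemma subsingleton_dominated (Z : mmSpace R) : dominated X Z.
Proof.
exists (fun=> point); split; first by move=> x y; rewrite mdistxx mdist_ge0.
split; first exact: measurable_cst.
move=> A _; rewrite /pushforward.
case: (dichotomy A) => ->; first by rewrite preimage_setT !probability_setT.
by rewrite preimage_set0 !measure0.
Qed.

Lemma subsingleton_parameter : parameter (fun=> point : X).
Proof.
split; first exact: measurable_cst.
move=> A _; case: (dichotomy A) => ->.
  rewrite preimage_setT setIT probability_setT.
  by rewrite lebesgue_measure_itv/= lte_fin ltr01 oppr0 adde0.
by rewrite preimage_set0 setI0 !measure0.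
Qed.

Lemma subsingleton_box_dist : box_dist X X = 0%E.
Proof.
apply/eqP; rewrite eq_le; apply/andP; split; last first.
  by apply: le_ereal_inf_tmp => _ [e [e0 _] <-]; rewrite lee_fin.
apply: ereal_inf_lbound; exists 0 => //; split=> //.
exists (fun=> point), (fun=> point).
split; [exact: subsingleton_parameter|exact: subsingleton_parameter|].
exists `[0, 1[%classic; split=> //.
  by rewrite subr0 lebesgue_measure_itv/= lte_fin ltr01 oppr0 adde0.
by move=> s t _ _; rewrite subrr normr0.
Qed.

Lemma subsingleton_iso : mm_iso X (one_point R).
Proof.
exists (fun=> tt); split.
- by exists (fun=> point) => [x|[]]; [exact: X1|].
- by move=> x y; rewrite (X1 x y) !mdistxx.
split; first exact: measurable_cst.
move=> A _; rewrite /pushforward /= diracE.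
have [At|At] := pselect (A tt).
  rewrite mem_set// (_ : _ @^-1` A = setT) ?probability_setT//.
  by apply/seteqP; split.
rewrite memNset// (_ : _ @^-1` A = set0) ?measure0//.
by apply/seteqP; split.
Qed.

End point_space.

(** * Separated sets in box-close spaces, and from Lévy families to weak convergence *)

Section box_separation.
Variable R : realType.

Lemma closed_borel (X : mmSpace R) (A : set X) : closed A ->
  measurable (A : set (borelType X)).
Proof.
move=> cA; rewrite -[A]setCK; apply: measurableC; apply: sub_sigma_algebra.
exact: closed_openC.
Qed.

(** Images under [psi] need not be Borel, so their closures are taken. Restricting to [I] costs at
    most [e] in mass, and passing from [phi] to [psi] at most [e] in distance. *)
Lemma parameter_set_dist (X Y : mmSpace R) (e k D : R)
    (phi : R -> X) (psi : R -> Y) (I : set (measurableTypeR R))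
    (B0 B1 : set (borelType X)) :
  parameter phi -> parameter psi -> measurable I -> I `<=` `[0, 1[ ->
  ((1 - e)%:E <= lebesgue_measure I)%E ->
  (forall s t, I s -> I t ->
     `|mdist (phi s) (phi t) - mdist (psi s) (psi t)| <= e) ->
  measurable B0 -> measurable B1 ->
  (forall x y, B0 x -> B1 y -> D <= mdist (x : X) y) ->
  ((k + e)%:E <= mm_mu X B0)%E -> ((k + e)%:E <= mm_mu X B1)%E ->
  ((D - e)%:E <= sep_dist Y k k)%E.
Proof.
move=> [mphi muphi] [mpsi mupsi] mI I01 eI Ie mB0 mB1 BD k0 k1.
pose A (B : set X) : set R := I `&` phi @^-1` B.
pose C (B : set X) : set Y := closure (psi @` A B).
have mC B : measurable (C B : set (borelType Y)).
  by apply: closed_borel; exact: closed_closure.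
have kC B : measurable (B : set (borelType X)) -> ((k + e)%:E <= mm_mu X B)%E ->
    (k%:E <= mm_mu Y (C B))%E.
  move=> mB kB.
  pose Z : set (measurableTypeR R) := `[0, 1[%classic `&` phi @^-1` B.
  have mZ : measurable Z by exact: mphi.
  have uI : unit_leb I = lebesgue_measure I by rewrite unit_lebE setIidr.
  have uZ : unit_leb Z = mm_mu X B.
    by rewrite unit_lebE setIidr ?muphi//; exact: subIsetl.
  have mIZ : measurable (I `&` Z) by exact: measurableI.
  have mIc : measurable (~` I) by exact: measurableC.
  have uIc : (unit_leb (~` I) <= e%:E)%E.
    rewrite [leLHS](probability_setC (@unit_leb R) mI).
    rewrite leeBlDr ?fin_num_measure// addeC -leeBlDr// -EFinB.
    by apply: (le_trans eI); rewrite -uI.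
  have kIZ : (k%:E <= unit_leb (I `&` Z))%E.
    have : (unit_leb Z <= unit_leb (I `&` Z) + unit_leb (~` I))%E.
      apply: le_trans (measureU2 _ mIZ mIc); apply: le_measure; rewrite ?inE//.
        exact: measurableU.
      by move=> t Zt; have [It|It] := pselect (I t); [left|right].
    rewrite uZ => /(le_trans kB)/le_trans/(_ (leeD2l _ uIc)).
    by rewrite EFinD leeD2rE.
  rewrite -mupsi//; apply: (le_trans kIZ).
  rewrite unit_lebE setIidr; last first.
    by move=> t [/I01].
  apply: le_measure; rewrite ?inE//; first exact: mpsi.
  move=> t [It [_ Bt]]; split; first exact: I01.
  by apply: subset_closure; exists t.
apply: (@le_trans _ _ (@set_dist R Y (C B0) (C B1))); last first.
  apply: ereal_sup_ubound; right; exists (C B0), (C B1).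
  by split=> //; exact: kC.
apply: le_ereal_inf_tmp => _ [p Cp [q Cq <-]]; rewrite lee_fin.
(* Points of the closures lie within [d / 2] of images under [psi], which costs an arbitrarily small
   [d]. *)
apply/ler_addgt0Pr => d d0.
have d2 : 0 < d / 2 by rewrite divr_gt0.
have [_ [[s [Is Bs] <-]]] := Cp _ (nbhsx_ballx p _ d2).
rewrite ballEmdist/= => ps.
have [_ [[t [It Bt] <-]]] := Cq _ (nbhsx_ballx q _ d2).
rewrite ballEmdist/= => qt.
have := BD _ _ Bs Bt; have := Ie _ _ Is It; rewrite ler_norml => /andP[_ ? ?].
have := metric_triangle (psi s) p (psi t).
have := metric_triangle p q (psi t).
by rewrite [mdist (psi s) p]metric_sym => ? ?; lra.
Qed.

Lemma metric_ball_open (T : metricType R) (x : T) (r : R) : open (ball x r).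
Proof.
rewrite openE => y; rewrite ballEmdist/= => xy.
apply/nbhs_ballP; exists (r - mdist x y); first by rewrite /= subr_gt0.
move=> z; rewrite !ballEmdist/= => yz.
by have := metric_triangle x y z; lra.
Qed.

Lemma limn_einf_ge (u : nat -> \bar R) (e : \bar R) (N : nat) :
  (forall n, (N <= n)%N -> (e <= u n)%E) -> (e <= limn_einf u)%E.
Proof.
move=> eu; rewrite limn_einf_lim; apply: lime_ge; first exact: is_cvg_einfs.
exists N => // n /= Nn; apply: le_ereal_inf_tmp => _ [i /= ni <-].
exact/eu/(leq_trans Nn).
Qed.

Lemma levy_weakly_converges (P : nat -> set (mmSpace R)) :
  (forall n, pyramid (P n)) -> levy_family P ->
  weakly_converges P (pyramid_point R).
Proof.
move=> hP lP.
have box_ge0 (X Y : mmSpace R) : (0 <= box_dist X Y)%E.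
  by apply: le_ereal_inf_tmp => _ [e [e0 _] <-]; rewrite lee_fin.
split=> X hX.
  have X1 : forall x y : X, x = y by move=> x y; exact: mm_iso_point hX.
  apply/nneg_cvge0P => [n|c c0].
    by apply: le_ereal_inf_tmp => _ [Y _ <-].
  exists 0%N => n _; apply: (@le_trans _ _ 0%E); last by rewrite lee_fin ltW.
  (* [X] itself belongs to [P n], being dominated by any of its members. *)
  rewrite -(subsingleton_box_dist X1); apply: ereal_inf_lbound; exists X => //.
  have [Z PZ] := pyramid_nonempty (hP n).
  exact: pyramid_down (hP n) _ _ PZ (subsingleton_dominated X1 Z).
have [x [y xy]] : exists x y : X, x != y.
  apply: contrapT => /forallNP h; apply: hX; apply: subsingleton_iso => x y.
  by apply/eqP/negPn/negP => xy; apply: (h x); exists y.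
(* Centres at distance [5 * r] put the balls of radius [r] at distance at least [3 * r]. *)
pose r := mdist x y / 5.
have r0 : 0 < r by rewrite divr_gt0// mdist_gt0.
have mB z : measurable (ball (z : X) r : set (borelType X)).
  by apply: sub_sigma_algebra; exact: metric_ball_open.
have muB z : exists2 k, 0 < k & (k%:E <= mm_mu X (ball (z : X) r))%E.
  exists (fine (mm_mu X (ball z r))); last by rewrite fineK// fin_num_measure.
  have : (0 < mm_mu X (ball z r))%E.
    have : supp (mm_mu X) z by rewrite mm_full_support.
    by apply; split; [exact: metric_ball_open|exact: ballxx].
  by move=> h; rewrite -lte_fin fineK// fin_num_measure.
have [kx kx0 hx] := muB x.
have [ky ky0 hy] := muB y.
(* Both balls keep mass at least [k] after a loss of [d < k], and the bound by [1] secures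
   [k + k < 1]. *)
pose k := Num.min (Num.min kx ky) 1 / 4.
have k0 : 0 < k by rewrite divr_gt0// !lt_min kx0 ky0 ltr01.
have k4 : 4 * k = Num.min (Num.min kx ky) 1 by rewrite /k mulrC divfK.
have kx4 : 4 * k <= kx by rewrite k4 !ge_min lexx.
have ky4 : 4 * k <= ky by rewrite k4 !ge_min lexx !orbT.
have k14 : 4 * k <= 1 by rewrite k4 !ge_min lexx !orbT.
have k1 : k + k < 1 by lra.
have /nneg_cvge0P := lP k k k0 k0 k1.
have Pn0 n := pyramid_nonempty (hP n).
move=> /(_ (fun n => pyr_sep_dist_ge0 _ _ (Pn0 n)) r r0)[N NP].
(* A box distance below [e] would give separation at least [3 * r - d > 2 * r], while it is at most
   [r] from [N] on. *)
pose e := Num.min k r.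
have e0 : 0 < e by rewrite lt_min k0.
have ek : e <= k by rewrite ge_min lexx.
have er : e <= r by rewrite ge_min lexx orbT.
apply: (@lt_le_trans _ _ e%:E); first by rewrite lte_fin.
apply: (@limn_einf_ge _ _ N) => n Nn.
apply: le_ereal_inf_tmp => _ [Y PY <-].
apply: le_ereal_inf_tmp.
move=> _ [d [d0 [phi [psi [pphi ppsi [I [mI I01 dI Id]]]]]] <-].
rewrite lee_fin leNgt; apply/negP => de.
have BD u v : ball x r u -> ball y r v -> 3 * r <= mdist u v.
  rewrite !ballEmdist/= => xu yv.
  have := metric_triangle x u y; have := metric_triangle u v y.
  rewrite [mdist v y]metric_sym => ? ?.
  have : mdist x y = 5 * r by rewrite /r mulrC divfK.
  lra.
have h4 : ((3 * r - d)%:E <= sep_dist Y k k)%E.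
  apply: (parameter_set_dist pphi ppsi mI I01 dI Id (mB x) (mB y) BD).
    by apply: le_trans hx; rewrite lee_fin; lra.
  by apply: le_trans hy; rewrite lee_fin; lra.
have := le_trans h4 (le_trans (pyr_sep_dist_ge k k PY) (NP n Nn)).
by rewrite lee_fin; lra.
Qed.
End box_separation.

(** * The three implications closed into a cycle *)

Theorem corollary5p8 (R : realType) (P : nat -> set (mmSpace R))
    (hP : forall n, pyramid (P n)) :
  (levy_family P <-> weakly_converges P (pyramid_point R)) /\
  (weakly_converges P (pyramid_point R) <->
   forall kappa : R, 0 < kappa ->
     pyr_obs_diam (P n) kappa @[n --> \oo] --> 0%E).
Proof.
have weak_obs : weakly_converges P (pyramid_point R) -> forall k : R, 0 < k ->
    pyr_obs_diam (P n) k @[n --> \oo] --> 0%E.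
  by move=> wP k; exact: weakly_converges_obs_diam.
have levy_weak := levy_weakly_converges hP.
have obs_levy := obs_diam_levy hP.
by split; split; auto.
Qed.
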